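(* Let $\xi$ be a random variable with values in $\{0,1,2,\dots\}$ with $\mathbb E\xi=1$ and $0<\operatorname{Var}\xi<\infty$. Then $\mathbb E\, Z_k(T_n^* )=O(k)$ uniformly in $k$ and $n$; that is, there exists a constant $C$, depending only on the distribution of $\xi$, such that $\mathbb E\,Z_k(T_n^* )\le C k$ for all $k\ge1$ and all $n\ge1$ with $\mathbb P(|\mathcal T|=n)>0$.
   Context: $\mathcal T$ is the Galton--Watson tree with offspring distribution $\xi$: the random rooted tree which is the family tree of the Galton--Watson process, started with one individual (the root), in which each individual has a number of children distributed as $\xi$, independently. $|\mathcal T|$ is its number of vertices. For $n$ with $\mathbb P(|\mathcal T|=n)>0$, the conditioned Galton--Watson tree $T_n$ is $\mathcal T$ conditioned on $|\mathcal T|=n$. $T_n^*$ is $T_n$ randomly rerooted: the same tree with all $n$ vertices, but with a new root chosen uniformly at random among the $n$ vertices. For a rooted tree $\tau$, $Z_k(\tau)$ is the number of vertices of $\tau$ at graph distance $k$ from the root. *)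

(* Defs.v *)
From HB Require Import structures.
From mathcomp Require Import all_boot all_order all_algebra finmap.
From mathcomp Require Import all_classical all_reals all_analysis.

Set Implicit Arguments.
Unset Strict Implicit.
Unset Printing Implicit Defensive.

Import Order.TTheory GRing.Theory Num.Theory.

Local Open Scope classical_set_scope.
Local Open Scope ring_scope.

(* Vertices are Ulam-Harris labels: [::] is the ancestor and rcons u i is the
   (i+1)-st child of u.  The edges of a tree are the parent-child pairs, so the
   root is independent of the labelling and need not be [::].                 *)
Record rooted_tree := RootedTree {
  vertices : set (seq nat);
  root : seq nat
}.

Definition adjacent (t : set (seq nat)) (u v : seq nat) : Prop :=
  [/\ t u, t v & exists i : nat, v = rcons u i \/ u = rcons v i].

Fixpoint walk (t : set (seq nat)) (k : nat) (u v : seq nat) : Prop :=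
  match k with
  | 0 => u = v
  | k'.+1 => exists2 w, adjacent t u w & walk t k' w v
  end.

Definition at_distance (t : set (seq nat)) (k : nat) (u v : seq nat) : Prop :=
  walk t k u v /\ forall j : nat, (j < k)%N -> ~ walk t j u v.

(* fset_set is fset0 on infinite sets, but a level of a locally finite tree is
   finite, so Z is the true count for every Galton-Watson tree.               *)
Definition Z (k : nat) (tau : rooted_tree) : nat :=
  #|` fset_set [set v | vertices tau v /\
                        at_distance (vertices tau) k (root tau) v] |.

Definition has_size (tau : rooted_tree) (n : nat) : Prop :=
  (vertices tau #= `I_n)%card.

Definition reroot (tau : rooted_tree) (v : seq nat) : rooted_tree :=
  RootedTree (vertices tau) v.

(* c u is the number of children of u, if u is ever born.                     *)
Definition family_tree (c : seq nat -> nat) : rooted_tree :=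
  RootedTree
    [set u | forall v i, prefix (rcons v i) u -> (i < c v)%N] [::].

Section probability.
Context {R : realType} {d : measure_display} {T : measurableType d}.
Variable P : probability T R.

Definition mutually_independent (I : choiceType) d' (S : measurableType d')
    (X : I -> {RV P >-> S}) : Prop :=
  forall (s : seq I) (B : I -> set S), uniq s ->
    (forall i, measurable (B i)) ->
    P (\bigcap_(i in [set` s]) (X i @^-1` B i)) =
    (\prod_(i <- s) P (X i @^-1` B i))%E.

Definition conditional_expectation (A : set T) (X : T -> R) : \bar R :=
  (((fine (P A))^-1)%:E * \int[P]_(w in A) (X w)%:E)%E.

(* The numbers of children are i.i.d. copies of xi; xi may live on another
   probability space.                                                         *)
Definition offspring_family d0 (T0 : measurableType d0)
    (P0 : probability T0 R) (xi : {RV P0 >-> nat})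
    (c : seq nat -> {RV P >-> nat}) : Prop :=
  mutually_independent c /\
  forall u (B : set nat), distribution P (c u) B = distribution P0 xi B.

Definition GW_tree (c : seq nat -> {RV P >-> nat}) (w : T) : rooted_tree :=
  family_tree (fun u => c u w).

Definition GW_has_size (c : seq nat -> {RV P >-> nat}) (n : nat) : set T :=
  [set w | has_size (GW_tree c w) n].

(* Given that the family tree is any fixed finite tree tau, V is a uniformly
   random vertex of tau; V is unconstrained where the tree is infinite.       *)
Definition uniform_vertex (c : seq nat -> {RV P >-> nat}) (V : T -> seq nat)
    : Prop :=
  (forall v, measurable (V @^-1` [set v])) /\
  forall (tau : rooted_tree) (n : nat) (v : seq nat),
    has_size tau n -> vertices tau v ->
    P [set w | GW_tree c w = tau /\ V w = v] =
    ((n%:R^-1)%:E * P [set w | GW_tree c w = tau])%E.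

(* E Z_k(T_n^* ), where T_n^* is the Galton-Watson tree conditioned to have n
   vertices, rerooted at V.                                                   *)
Definition expected_level (c : seq nat -> {RV P >-> nat}) (V : T -> seq nat)
    (n k : nat) : \bar R :=
  conditional_expectation (GW_has_size c n)
    (fun w => (Z k (reroot (GW_tree c w) (V w)))%:R).

End probability.

(* Main.v *)
Require Import Defs.
From HB Require Import structures.
From mathcomp Require Import all_boot all_order all_algebra finmap.
From mathcomp Require Import all_classical all_reals all_analysis measurable_realfun.
From mathcomp Require Import ring lra zify.

Import Order.TTheory GRing.Theory Num.Theory.
Import numFieldNormedType.Exports.

Set Implicit Arguments.
Unset Strict Implicit.
Unset Printing Implicit Defensive.

Local Open Scope classical_set_scope.
Local Open Scope ring_scope.

(** The expected number of vertices at distance k from a uniformly random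
    vertex of T_n is 1/n times the expected number of ordered pairs of vertices
    of T_n at distance k.  So the claim is that this number of pairs has
    expectation at most C k n.

    Trees with n vertices only see the offspring probabilities below n, so the
    offspring law may be replaced by a polynomial phi, its generating function
    cut off at a high degree.  The generating series T of trees satisfies
    T = z phi(T).  A pair of vertices at distance k >= 1 has a last common
    ancestor.  Either it is one end of the pair, or the path leaves it through
    two different children, with k - 1 choices for the length of the first arm.
    A vertex with one marked child contributes a factor z phi'(T), be it inside
    one of the two arms or strictly above the last common ancestor; a vertex
    with two marked children contributes z phi''(T).
    Hence the pairs have the generating series ([tree_sum_pairs])

      (2 (z phi'(T))^k T + (k-1) z phi''(T) (z phi'(T))^(k-2) T^2)
        / (1 - z phi'(T)).

    Lagrange inversion, in the form [z^n] psi(T) / (1 - z phi'(T)) =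
    [y^n] psi(y) phi(y)^n ([lagrange]), turns these coefficients into
    statements on a sum S_n of n independent offspring numbers xi_1, ..., xi_n.
    It gives P(|T| = n) = P(S_n = n-1) / n ([cycle_lemma]), and n times the
    conditional expectation wanted is

      (2 E[xi_1 ... xi_k ; S_n = n-1]
        + (k-1) E[xi_1 (xi_1 - 1) xi_2 ... xi_(k-1) ; S_n = n-1]) / P(|T| = n).

    The offspring numbers are integers: where a product of some of them is not
    zero these are all at least 1, so the remaining ones have average at most 1
    given S_n = n-1.  By exchangeability the factors can be dropped one at a
    time ([coef_deriv_exp_le], [coef_spine_le]).  What remains is
    2 P(S_n = n-1) + (k-1) E[xi_1 (xi_1 - 1) ; S_n = n-1] ([pairs_bound]), and
    the claim follows once E[xi_1 (xi_1 - 1) | S_n = n-1] is bounded in n.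

    As xi has a second moment, it suffices that P(S_(n-1) = t) is at most a
    constant times P(S_n = n-1), uniformly in t ([local_limit_ratio]).  Both
    are of order n^(-1/2), which is proved without Fourier analysis.  Let h be
    the span of the lattice generated by the offspring numbers.  For some m the
    law of S_m has a component that is a shifted copy of h times a binomial
    variable with parameters 2 and 1/2 ([lattice_block]).  So the law of S_n is
    a mixture of shifted copies of h times binomial variables with parameters
    2N and 1/2, where N is itself binomial ([expansion]).  The upper bound is
    the size of the central binomial coefficient, averaged over N by means of
    E[1/(N+1)] ([coef_upper]).  For the lower bound, Chebyshev's inequality puts
    most of the centres of these binomial laws within O(sqrt n) of n, and N is
    rarely small; in this window a binomial law is comparable with its value at
    the centre ([coef_lower]).  If the offspring number is never 0, no tree is
    finite and P(S_n = n-1) = 0. *)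

(** * Formal power series *)

(** A name of its own keeps the convolution product apart from the pointwise
    product that functions already carry. *)
Definition series (R : Type) := nat -> R.

Section PowerSeries.
Variable R : comNzRingType.
Implicit Types f g h : series R.

HB.instance Definition _ := GRing.Zmodule.copy (series R) (nat -> R).

Definition series_one : series R := fun n => (n == 0%N)%:R.

Definition series_mul f g : series R :=
  fun n => \sum_(i < n.+1) f i * g (n - i)%N.

(** Products of series reduce to products of polynomials on each initial
    segment of coefficients, and inherit their ring laws. *)
Definition jet n f : {poly R} := \poly_(i < n.+1) f i.

Lemma coef_jet n f i : (i <= n)%N -> (jet n f)`_i = f i.
Proof. by move=> le_in; rewrite coef_poly ltnS le_in. Qed.

Lemma series_mul_jet n f g i : (i <= n)%N ->
  series_mul f g i = (jet n f * jet n g)`_i.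
Proof.
move=> le_in; rewrite coefM; apply: eq_bigr => j _.
rewrite !coef_jet //; first exact: leq_trans (leq_subr _ _) le_in.
by apply: leq_trans le_in; rewrite -ltnS.
Qed.

Lemma series_mulC : commutative series_mul.
Proof.
by move=> f g; apply/funext => n; rewrite !(@series_mul_jet n) // mulrC.
Qed.

Lemma series_mulA : associative series_mul.
Proof.
move=> f g h; apply/funext => n.
have -> : series_mul f (series_mul g h) n = (jet n f * (jet n g * jet n h))`_n.
  rewrite coefM; apply: eq_bigr => i _.
  rewrite coef_jet; last by rewrite -ltnS.
  by rewrite (@series_mul_jet n) ?leq_subr.
rewrite mulrA coefM; apply: eq_bigr => i _.
by rewrite (@coef_jet _ h) ?leq_subr // (@series_mul_jet n) -1?ltnS.
Qed.

Lemma series_mul1 : left_id series_one series_mul.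
Proof.
move=> f; apply/funext => n; rewrite /series_mul big_ord_recl /= subn0 mul1r.
by rewrite big1 ?addr0 // => i _; rewrite /series_one mul0r.
Qed.

Lemma series_mulDl : left_distributive series_mul (@GRing.add (series R)).
Proof.
move=> f g h; apply/funext => n; rewrite /series_mul -[RHS]big_split /=.
by apply: eq_bigr => i _; rewrite -mulrDl.
Qed.

Lemma series_one_neq0 : series_one != 0 :> series R.
Proof.
by apply/eqP => /(congr1 (fun f => f 0%N)) /eqP; rewrite /= oner_eq0.
Qed.

HB.instance Definition _ := GRing.Zmodule_isComNzRing.Build (series R)
  series_mulA series_mulC series_mul1 series_mulDl series_one_neq0.

Lemma coef_seriesM f g n : (f * g) n = \sum_(i < n.+1) f i * g (n - i)%N.
Proof. by []. Qed.

Lemma coef_seriesD f g n : (f + g) n = f n + g n.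
Proof. by []. Qed.

Lemma coef_series1 n : (1 : series R) n = (n == 0%N)%:R.
Proof. by []. Qed.

Lemma coef_series_sum I (r : seq I) (F : I -> series R) n :
  (\sum_(i <- r) F i) n = \sum_(i <- r) F i n.
Proof. by apply: (big_morph (fun f : series R => f n)). Qed.

Lemma coef_seriesMn f m n : (f *+ m) n = f n *+ m.
Proof. by elim: m => // m IHm; rewrite !mulrS coef_seriesD IHm. Qed.

Definition zvar : series R := fun n => (n == 1%N)%:R.

Lemma coef_zvarM f n : (zvar * f) n = if n is m.+1 then f m else 0.
Proof.
case: n => [|n]; rewrite coef_seriesM.
  by rewrite big_ord1 /zvar mul0r.
rewrite big_ord_recl big_ord_recl /= {1}/zvar mul0r add0r.
rewrite /zvar mul1r /= subSS subn0.
by rewrite big1 ?addr0 // => i _; rewrite mul0r.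
Qed.

Definition cseries (c : R) : series R := fun n => c *+ (n == 0%N).

Lemma cseries_is_additive : additive cseries.
Proof. by move=> a b; apply/funext => n; rewrite /cseries mulrnBl. Qed.

Lemma coef_cseriesM c f n : (cseries c * f) n = c * f n.
Proof.
rewrite coef_seriesM big_ord_recl /= subn0 /cseries.
by rewrite big1 ?addr0 // => i _; rewrite mul0r.
Qed.

Lemma cseries_is_multiplicative : monoid_morphism cseries.
Proof.
split; first by [].
by move=> a b; apply/funext => n; rewrite coef_cseriesM /cseries mulrnAr.
Qed.

HB.instance Definition _ := GRing.isZmodMorphism.Build R (series R) cseries
  cseries_is_additive.
HB.instance Definition _ := GRing.isMonoidMorphism.Build R (series R) cseries
  cseries_is_multiplicative.

(** The derivation z d/dz. *)
Definition theta f : series R := fun n => n%:R * f n.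

Lemma thetaD f g : theta (f + g) = theta f + theta g.
Proof. by apply/funext => n; rewrite /theta coef_seriesD mulrDr. Qed.

Lemma thetaM f g : theta (f * g) = theta f * g + f * theta g.
Proof.
apply/funext => n; rewrite coef_seriesD !coef_seriesM /theta coef_seriesM.
rewrite mulr_sumr -big_split; apply: eq_bigr => -[i /= le_in] _.
rewrite [in RHS]mulrCA -[in RHS]mulrA -mulrDl -natrD subnKC // mulrA.

Qed.

End PowerSeries.

(** * Substitution and Lagrange inversion *)

Section Substitution.
Variable R : comNzRingType.
Implicit Types (f g T : series R) (p q : {poly R}).

Definition psubst T p : series R := (map_poly (@cseries R) p).[T].

Lemma psubstM T p q : psubst T (p * q) = psubst T p * psubst T q.
Proof. by rewrite /psubst rmorphM hornerM. Qed.

Lemma psubstX T : psubst T 'X = T.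
Proof. by rewrite /psubst map_polyX hornerX. Qed.

Lemma psubstXn T n : psubst T ('X ^+ n) = T ^+ n.
Proof. by elim: n => [|n IHn]; rewrite ?exprS ?psubstM ?IHn ?psubstX //
  expr0 /psubst rmorph1 hornerC. Qed.

Lemma psubst_exp T p n : psubst T (p ^+ n) = psubst T p ^+ n.
Proof. by rewrite /psubst rmorphXn horner_exp. Qed.

Lemma psubstC T c : psubst T c%:P = cseries c.
Proof. by rewrite /psubst map_polyC hornerC. Qed.

Lemma psubst_sum T I (r : seq I) (F : I -> {poly R}) :
  psubst T (\sum_(i <- r) F i) = \sum_(i <- r) psubst T (F i).
Proof. by rewrite /psubst rmorph_sum horner_sum. Qed.

Lemma psubstE T p :
  psubst T p = \sum_(i < size p) cseries p`_i * T ^+ i.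
Proof.
rewrite -{1}[p]coefK poly_def psubst_sum; apply: eq_bigr => i _.
by rewrite -mul_polyC psubstM psubstC psubstXn.
Qed.

Lemma psubst_deriv T p :
  psubst T p^`() = \sum_(i < size p) cseries p`_i * (T ^+ i.-1 *+ i).
Proof.
rewrite -{1}[p]coefK poly_def (raddf_sum (@deriv R)) /= psubst_sum; apply: eq_bigr => i _.
rewrite derivZ derivXn -mul_polyC psubstM psubstC -mulr_natl psubstM.
by rewrite psubstXn -polyC_natr psubstC rmorph_nat mulr_natl.
Qed.

Lemma mul_poly_sum p q : p * q = \sum_(i < size p) p`_i *: ('X ^+ i * q).
Proof.
rewrite -{1}[p]coefK poly_def mulr_suml; apply: eq_bigr => i _.
by rewrite -scalerAl.
Qed.

Lemma theta_exp f n : theta (f ^+ n) = f ^+ n.-1 *+ n * theta f.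
Proof.
elim: n => [|n IHn].
  rewrite mulr0n mul0r expr0; apply/funext => i; rewrite /theta coef_series1.
  by case: i => [|i]; rewrite ?mul0r ?mulr0.
rewrite exprS thetaM IHn /=; case: n {IHn} => [|n] /=; first by rewrite expr0 mulr1n; ring.
by rewrite exprS; ring.
Qed.

(** The chain rule for z d/dz. *)
Lemma theta_psubst T p : theta (psubst T p) = psubst T p^`() * theta T.
Proof.
rewrite psubst_deriv psubstE mulr_suml.
have theta0 : theta (0 : series R) = 0.
  by apply/funext => i; rewrite /theta mulr0.
rewrite (big_morph _ (@thetaD R) theta0); apply: eq_bigr => i _.
rewrite -mulrA -theta_exp; apply/funext => n.
by rewrite /theta !coef_cseriesM mulrCA.
Qed.

End Substitution.

Section Lagrange.
Variable R : numFieldType.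
Variables (phi : {poly R}) (T : series R).
Hypothesis T_eq : T = zvar R * psubst T phi.

(** By [diagonal_eq] this is 1 / (1 - z phi'(T)). *)
Definition diagonal : series R := fun n => (phi ^+ n)`_n.

(** Both sides satisfy the same recurrence in n, obtained by exploring one more
    vertex: on the left T = z phi(T) is used for one factor T, on the right one
    factor phi is split off.  In terms of the walk with steps xi - 1, a path to
    level -r is cut at its first hitting times of -1, ..., -r. *)
Lemma lagrange_exp n r : (T ^+ r * diagonal) n = ('X ^+ r * phi ^+ n)`_n.
Proof.
elim: n r => [|n IHn] [|r]; rewrite ?expr0 ?mul1r //.
  by rewrite exprS {1}T_eq -!mulrA coef_zvarM coefXnM.
rewrite exprS {1}T_eq -!mulrA coef_zvarM psubstE mulr_suml coef_series_sum.
rewrite exprS -mulrA coefXM /= exprS mulrCA mul_poly_sum coef_sum.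
apply: eq_bigr => i _.
by rewrite coefZ -mulrA coef_cseriesM !mulrA -!exprD IHn.
Qed.

Lemma lagrange psi n : (psubst T psi * diagonal) n = (psi * phi ^+ n)`_n.
Proof.
rewrite psubstE mulr_suml coef_series_sum mul_poly_sum coef_sum.
by apply: eq_bigr => i _; rewrite coefZ -mulrA coef_cseriesM lagrange_exp.
Qed.

Lemma lagrange_shift j psi n :
  (zvar R ^+ j * psubst T psi * diagonal) n =
  if (j <= n)%N then (psi * phi ^+ (n - j))`_(n - j) else 0.
Proof.
elim: j n => [|j IHj] n; first by rewrite expr0 mul1r subn0 lagrange.
by rewrite exprS -!mulrA coef_zvarM; case: n => // n; rewrite mulrA IHj.
Qed.

(** Given the value of a sum of exchangeable variables, the mean of one of them
    is the average.  Here it is the derivative of a power. *)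
Lemma coef_deriv_exp m s :
  (phi^`() * phi ^+ m)`_s = s.+1%:R / m.+1%:R * (phi ^+ m.+1)`_s.+1.
Proof.
have := congr1 (fun p : {poly R} => p`_s) (deriv_exp phi m.+1).
rewrite coef_deriv coefMn /= => E.
apply: (mulfI (x := m.+1%:R)); first by rewrite pnatr_eq0.
by rewrite mulrA mulrCA mulfV ?pnatr_eq0 // mulr1 !mulr_natl E.
Qed.

(** In coefficients, E[xi_1 ; S_n = n] = P(S_n = n). *)
Lemma diagonal_eq : (1 - zvar R * psubst T phi^`()) * diagonal = 1.
Proof.
rewrite mulrBl mul1r; apply/eqP; rewrite subr_eq; apply/eqP/funext => n.
rewrite coef_seriesD coef_series1 -mulrA coef_zvarM.
case: n => [|n]; first by rewrite /diagonal expr0 coef1 addr0.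
by rewrite lagrange coef_deriv_exp divff ?pnatr_eq0 // mul1r add0r.
Qed.

Lemma solve_renewal (f g : series R) :
  f = g + zvar R * psubst T phi^`() * f -> f = g * diagonal.
Proof.
move=> fE; have -> : g = (1 - zvar R * psubst T phi^`()) * f.
  by rewrite mulrBl mul1r {1}fE addrK.
by rewrite mulrAC diagonal_eq mul1r.
Qed.

(** Marking a vertex of a tree is applying z d/dz, and differentiating
    T = z phi(T) gives theta T = T / (1 - z phi'(T)). *)
Lemma cycle_lemma n : n%:R * T n = ('X * phi ^+ n)`_n.
Proof.
rewrite -lagrange psubstX; suff <- : theta T = T * diagonal by [].
apply: solve_renewal; rewrite {1}T_eq thetaM theta_psubst mulrA.
congr (_ + _); rewrite [RHS]T_eq; congr (_ * _); apply/funext => i.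
by case: i => [|[|i]]; rewrite /theta /zvar /= ?mulr0 ?mul1r.
Qed.

End Lagrange.

(** * Plane forests and their generating series *)

(** A plane forest is coded by the forest of the children of the root of its
    first tree and the forest of the remaining trees; a plane tree is coded by
    the forest of the children of its root.  This avoids nested induction. *)
Inductive forest := Empty | Graft of forest & forest.

HB.instance Definition _ := gen_eqMixin forest.

Fixpoint nroots a := if a is Graft _ b then (nroots b).+1 else 0%N.

Fixpoint nverts a := if a is Graft a b then (nverts a + nverts b).+1 else 0%N.

(** The argument h is fuel: any h >= n gives all forests with n vertices. *)
Fixpoint forests_rec h n : seq forest :=
  match n, h with
  | 0, _ => [:: Empty]
  | _.+1, 0 => [::]
  | n'.+1, h'.+1 =>
      flatten [seq [seq Graft a b | a <- forests_rec h' i,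
                                    b <- forests_rec h' (n' - i)%N]
              | i <- iota 0 n'.+1]
  end.

Definition forests n := forests_rec n n.

Lemma forests_recS h n : forests_rec h.+1 n.+1 =
  flatten [seq [seq Graft a b | a <- forests_rec h i,
                                b <- forests_rec h (n - i)%N]
          | i <- iota 0 n.+1].
Proof. by []. Qed.

Lemma forests_rec_stable h n : (n <= h)%N -> forests_rec h n = forests n.
Proof.
have [m] := ubnP n; elim: m => // m IHm in n h *.
case: n => [|n] lt_nm; first by case: h.
case: h => // h le_nh; rewrite /forests !forests_recS; congr flatten.
apply/eq_in_map => i; rewrite mem_iota add0n ltnS => /= le_in.
by rewrite !IHm //; lia.
Qed.

Lemma forestsS n : forests n.+1 =
  flatten [seq [seq Graft a b | a <- forests i, b <- forests (n - i)%N]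
          | i <- iota 0 n.+1].
Proof.
rewrite {1}/forests forests_recS; congr flatten; apply/eq_in_map => i.
by rewrite mem_iota add0n ltnS => /= le_in; rewrite !forests_rec_stable ?leq_subr.
Qed.

Lemma sum_forestsS (V : nmodType) n (F : forest -> V) :
  \sum_(c <- forests n.+1) F c =
  \sum_(i < n.+1) \sum_(a <- forests i) \sum_(b <- forests (n - i)) F (Graft a b).
Proof.
rewrite forestsS big_flatten big_map -[iota 0 n.+1]/(index_iota 0 n.+1) big_mkord.
by apply: eq_bigr => i _; rewrite big_allpairs_dep.
Qed.

Lemma nverts_forests n a : a \in forests n -> nverts a = n.
Proof.
have [m] := ubnP n; elim: m => // m IHm in n a *.
case: n => [|n] lt_nm; first by rewrite inE => /eqP ->.
rewrite forestsS => /flatten_mapP[i]; rewrite mem_iota add0n ltnS => /= le_in.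
by case/allpairsPdep => b [c] [/IHm Eb /IHm Ec ->]; rewrite /= Eb ?Ec; lia.
Qed.

(** Every forest occurs exactly once in the enumeration; stated as a sum, this
    can be proved by the recursion of [sum_forestsS] and used directly. *)
Lemma sum_forests_pick (V : nmodType) n c (v : V) :
  \sum_(a <- forests n) (if a == c then v else 0) =
  if nverts c == n then v else 0.
Proof.
elim: c n v => [|c1 IH1 c2 IH2] [|n] v.
- by rewrite /forests /= big_seq1 eqxx.
- rewrite sum_forestsS big1 // => i _; rewrite big1 // => a _.
  by rewrite big1 // => b _; rewrite ifF //; apply/eqP.
- by rewrite /forests /= big_seq1 ifF //; apply/eqP.
rewrite sum_forestsS /= eqSS.
have E i : \sum_(a <- forests i) \sum_(b <- forests (n - i))
      (if Graft a b == Graft c1 c2 then v else 0) =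
    if nverts c1 == i then (if nverts c2 == (n - i)%N then v else 0) else 0.
  rewrite -IH1; apply: eq_bigr => a _; case: (eqVneq a c1) => [->|ne].
    rewrite -IH2; apply: eq_bigr => b _; congr (if _ then _ else _).
    by apply/eqP/eqP => [[]|->].
  by rewrite big1 // => b _; rewrite ifF //; apply/eqP => -[E]; rewrite E eqxx in ne.
under eq_bigr do rewrite E.
have [le_cn|lt_nc] := leqP (nverts c1) n.
  rewrite (bigD1 (Ordinal (le_cn : nverts c1 < n.+1)%N)) //= eqxx big1 ?addr0.
    by congr (if _ then _ else _); apply/eqP/eqP; lia.
  by move=> i /eqP ne; rewrite ifF //; apply/eqP => E'; apply: ne; apply: val_inj.
rewrite ifF; last by apply/eqP; lia.
by rewrite big1 // => i _; rewrite ifF //; apply/eqP; have := ltn_ord i; lia.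
Qed.

Lemma mem_forests n a : (a \in forests n) = (nverts a == n).
Proof.
apply/idP/eqP => [/nverts_forests //|En]; apply: contraT => a_n.
have := sum_forests_pick n a 1%N; rewrite En eqxx big_seq big1 // => b b_n.
by rewrite ifF //; apply: contraNF a_n => /eqP <-.
Qed.

Section TreeSums.
Variables (R : comNzRingType) (p : nat -> R).

Fixpoint weight a : R :=
  if a is Graft a b then p (nroots a) * weight a * weight b else 1.

Definition forest_sum (g : forest -> R) : series R :=
  fun n => \sum_(a <- forests n) weight a * g a.

(** Here g is evaluated at the forest of the children of the root, and the
    factor z stands for the root. *)
Definition tree_sum (g : forest -> R) : series R :=
  zvar R * forest_sum (fun a => p (nroots a) * g a).

Lemma eq_forest_sum g1 g2 : g1 =1 g2 -> forest_sum g1 = forest_sum g2.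
Proof.
by move=> eq_g; apply/funext => n; apply: eq_bigr => a _; rewrite eq_g.
Qed.

Lemma eq_tree_sum g1 g2 : g1 =1 g2 -> tree_sum g1 = tree_sum g2.
Proof. by move=> eq_g; congr (_ * _); apply: eq_forest_sum => a; rewrite eq_g. Qed.

Lemma forest_sumD g1 g2 :
  forest_sum (fun a => g1 a + g2 a) = forest_sum g1 + forest_sum g2.
Proof.
apply/funext => n; rewrite coef_seriesD -big_split.
by apply: eq_bigr => a _; rewrite mulrDr.
Qed.

Lemma tree_sumD g1 g2 :
  tree_sum (fun a => g1 a + g2 a) = tree_sum g1 + tree_sum g2.
Proof.
rewrite -mulrDr -forest_sumD; congr (_ * _).
by apply: eq_forest_sum => a; rewrite mulrDr.
Qed.

Lemma tree_sumMn g m : tree_sum (fun a => g a *+ m) = tree_sum g *+ m.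
Proof.
elim: m => [|m IHm]; last first.
  by rewrite mulrS -IHm -tree_sumD; apply: eq_tree_sum => a; rewrite mulrS.
rewrite mulr0n /tree_sum -[RHS](mulr0 (zvar R)); congr (_ * _).
by apply/funext => n; rewrite /forest_sum big1 // => a _; rewrite !mulr0.
Qed.

Lemma forest_sum_graft g g1 g2 : g Empty = 0 ->
  (forall a b, g (Graft a b) = g1 a * g2 b) ->
  forest_sum g = tree_sum g1 * forest_sum g2.
Proof.
move=> g0 gG; apply/funext => n; rewrite -mulrA coef_zvarM /forest_sum.
case: n => [|n]; first by rewrite big_seq1 g0 mulr0.
rewrite sum_forestsS coef_seriesM; apply: eq_bigr => i _.
rewrite mulr_suml; apply: eq_bigr => a _.
rewrite mulr_sumr; apply: eq_bigr => b _; rewrite gG /=; ring.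
Qed.

(** The number of roots is fixed in order to bring in the power of T that the
    remaining trees of the forest contribute. *)
Definition on_roots r (g : forest -> R) a := (nroots a == r)%:R * g a.

Lemma forest_sum_Empty : forest_sum (on_roots 0 (fun=> 1)) = 1.
Proof.
apply/funext => -[|n]; rewrite coef_series1 /forest_sum.
  by rewrite big_seq1 /on_roots /= !mul1r.
rewrite big_seq big1 // => a; rewrite mem_forests /on_roots.
by case: a => // a b _ /=; rewrite mul0r mulr0.
Qed.

Lemma forest_sum_roots r : forest_sum (on_roots r (fun=> 1)) = tree_sum (fun=> 1) ^+ r.
Proof.
elim: r => [|r IHr]; first exact: forest_sum_Empty.
rewrite exprS -IHr; apply: forest_sum_graft => [|a b]; first by rewrite /on_roots mul0r.
by rewrite /on_roots /= eqSS mul1r.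
Qed.

Lemma forest_sum_on0 g : g Empty = 0 -> forest_sum (on_roots 0 g) = 0.
Proof.
move=> g0; apply/funext => n; rewrite /forest_sum big1 // => -[|a b] _.
  by rewrite /on_roots g0 !mulr0.
by rewrite /on_roots mul0r mulr0.
Qed.

Definition additive_over_trees (h h0 : forest -> R) :=
  h Empty = 0 /\ forall a b, h (Graft a b) = h0 a + h b.

(** One of the r trees carries h0 and the r - 1 others are free. *)
Lemma forest_sum_additive h h0 r : additive_over_trees h h0 ->
  forest_sum (on_roots r h) = tree_sum (fun=> 1) ^+ r.-1 *+ r * tree_sum h0.
Proof.
case=> hE hG; elim: r => [|r IHr]; first by rewrite mulr0n mul0r forest_sum_on0.
have -> : forest_sum (on_roots r.+1 h) =
    tree_sum h0 * tree_sum (fun=> 1) ^+ r + tree_sum (fun=> 1) * forest_sum (on_roots r h).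
  rewrite -forest_sum_roots.
  rewrite -(@forest_sum_graft (fun a => if a is Graft a b then
     h0 a * on_roots r (fun=> 1) b else 0)) //.
  rewrite -(@forest_sum_graft (fun a => if a is Graft a b then
     1 * on_roots r h b else 0)) // -forest_sumD.
  apply: eq_forest_sum => -[|a b]; first by rewrite /on_roots mul0r addr0.
  by rewrite /on_roots /= eqSS hG; ring.
rewrite IHr; case: r {IHr} => [|r] /=; first by rewrite expr0; ring.
by rewrite exprS; ring.
Qed.

End TreeSums.

Section PolynomialWeights.
Variables (R : comNzRingType) (phi : {poly R}).
Let p i := phi`_i.
Let T : series R := tree_sum p (fun=> 1).

Lemma tree_sum_by_roots g :
  tree_sum p g = zvar R * \sum_(r < size phi) cseries phi`_r * forest_sum p (on_roots r g).
Proof.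
congr (_ * _); apply/funext => n; rewrite coef_series_sum.
under eq_bigr do rewrite coef_cseriesM mulr_sumr.
rewrite exchange_big /=; apply: eq_bigr => a _; rewrite mulrCA.
have [lt_a|ge_a] := ltnP (nroots a) (size phi).
  rewrite (bigD1 (Ordinal lt_a)) //= big1 ?addr0 => [|i ne_i].
    by rewrite /on_roots eqxx mul1r.
  rewrite /on_roots (_ : _ == _ = false) ?mul0r ?mulr0 //.
  by apply: contraNF ne_i => /eqP E; apply/eqP/val_inj.
rewrite /p nth_default // mul0r big1 // => i _.
rewrite /on_roots (_ : _ == _ = false) ?mul0r ?mulr0 //.
by apply/eqP => E; have := ltn_ord i; rewrite -E ltnNge ge_a.
Qed.

Lemma tree_series_eq : T = zvar R * psubst T phi.
Proof.
rewrite {1}/T tree_sum_by_roots psubstE; congr (_ * _).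
by apply: eq_bigr => i _; rewrite forest_sum_roots.
Qed.

(** A vertex with a marked child is worth z phi'(T). *)
Lemma tree_sum_additive h h0 : additive_over_trees h h0 ->
  tree_sum p h = zvar R * psubst T phi^`() * tree_sum p h0.
Proof.
move=> hh; rewrite tree_sum_by_roots psubst_deriv -mulrA mulr_suml.
congr (_ * _); apply: eq_bigr => i _.
by rewrite (forest_sum_additive _ _ hh) !mulrA.
Qed.

End PolynomialWeights.

(** * Pairs of vertices at a given distance *)

Fixpoint level k a : nat :=
  if a is Graft a b then
    ((if k is k'.+1 then level k' a else 1) + level k b)%N
  else 0%N.

Definition tree_level k a : nat := if k is k'.+1 then level k' a else 1%N.

(** Ordered pairs of vertices in different trees of the forest, whose depths
    in the forest add up to d; joined through a new common root, such vertices
    are at distance d + 2. *)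
Fixpoint cross d a : nat :=
  if a is Graft a b then
    (2 * (\sum_(i < d.+1) tree_level i a * level (d - i) b) + cross d b)%N
  else 0%N.

(** Ordered pairs at distance k whose last common ancestor is the root. *)
Definition apex_pairs k a : nat :=
  (2 * tree_level k a + if k is d.+2 then cross d a else 0)%N.

Fixpoint pairs k a : nat :=
  if a is Graft a b then (apex_pairs k a + pairs k a + pairs k b)%N else 0%N.

Definition tree_pairs k a := pairs k (Graft a Empty).
Arguments tree_pairs : simpl never.

Section PairSums.
Variables (R : numFieldType) (phi : {poly R}).
Let p i := phi`_i.
Let T : series R := tree_sum p (fun=> 1).
Let spine : series R := zvar R * psubst T phi^`().

Lemma tree_sum_level k :
  tree_sum p (fun a => (tree_level k a)%:R) = spine ^+ k * T.
Proof.
elim: k => [|k IHk]; first by rewrite expr0 mul1r.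
rewrite exprS -mulrA -IHk; apply: tree_sum_additive; split=> // a b.
by rewrite -natrD; case: (k).
Qed.

Lemma forest_sum_big I (r : seq I) (G : I -> forest -> R) :
  forest_sum p (fun a => \sum_(i <- r) G i a) = \sum_(i <- r) forest_sum p (G i).
Proof.
apply/funext => n; rewrite coef_series_sum exchange_big.
by apply: eq_bigr => a _; rewrite mulr_sumr.
Qed.

(** Two of the r trees carry the ends of the pair, at depths i and d - i; the
    contribution of the pair does not depend on i. *)
Lemma forest_sum_cross d r :
  forest_sum p (on_roots r (fun a => (cross d a)%:R)) =
  T ^+ (r - 2) *+ (r * r.-1) * (spine ^+ d * T ^+ 2) *+ d.+1.
Proof.
elim: r => [|r IHr].
  by rewrite forest_sum_on0 // mulr0n mul0r mul0rn.
have pair_sum i : (i <= d)%N ->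
    tree_sum p (fun a => (tree_level i a)%:R) *
      forest_sum p (on_roots r (fun b => (level (d - i) b)%:R)) =
    T ^+ r.-1 *+ r * (spine ^+ d * T ^+ 2).
  move=> le_id; rewrite (@forest_sum_additive _ p _ (fun a => (tree_level (d - i) a)%:R)).
    by rewrite !tree_sum_level -{2}(subnKC le_id) exprD -/T expr2; ring.
  by split=> // a b; rewrite -natrD /=; case: (d - i)%N.
have -> : forest_sum p (on_roots r.+1 (fun a => (cross d a)%:R)) =
    (\sum_(i < d.+1) T ^+ r.-1 *+ r * (spine ^+ d * T ^+ 2)) *+ 2 +
    T * forest_sum p (on_roots r (fun a => (cross d a)%:R)).
  under eq_bigr => i _ do rewrite -(@pair_sum i) -1?ltnS //.
  rewrite mulr2n -(@forest_sum_graft _ p (fun a => if a is Graft a b then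
     1 * on_roots r (fun a => (cross d a)%:R) b else 0)) //.
  pose G i a := if a is Graft a b then (tree_level i a)%:R *
     on_roots r (fun b => (level (d - i) b)%:R) b else 0 : R.
  have GE i : tree_sum p (fun a => (tree_level i a)%:R) *
      forest_sum p (on_roots r (fun b => (level (d - i) b)%:R)) = forest_sum p (G i).
    by rewrite -(@forest_sum_graft _ p (G i)).
  under eq_bigr do rewrite GE.
  rewrite -forest_sum_big -!forest_sumD; apply: eq_forest_sum => -[|a b].
    by rewrite /on_roots mul0r /G big1 // !addr0.
  rewrite /on_roots /= eqSS natrD natrM natr_sum mulrDr mul1r; congr (_ + _).
  rewrite mulrCA mulr_natl mulr2n mulr_sumr; congr (_ + _);
  by apply: eq_bigr => i _; rewrite /G /on_roots natrM; ring.
rewrite IHr big_const_ord iter_addr_0.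
case: r {IHr pair_sum} => [|[|r]].
- by rewrite !mulr0n !mul0r !mul0rn mulr0 addr0.
- by rewrite /= !muln0 subnn expr0; ring.
rewrite /= !subSS !subn0 [T ^+ r.+1]exprS; ring.
Qed.

Lemma tree_sum_cross d :
  tree_sum p (fun a => (cross d a)%:R) =
  (zvar R ^+ d.+1 * psubst T (phi^`()^`() * phi^`() ^+ d * 'X ^+ 2)) *+ d.+1.
Proof.
have psubst_deriv2 : psubst T phi^`()^`() =
    \sum_(i < size phi) cseries phi`_i * (T ^+ (i - 2) *+ (i * i.-1)).
  rewrite -{1}[phi]coefK poly_def (raddf_sum (@deriv R)) /= (raddf_sum (@deriv R)) /= psubst_sum.
  apply: eq_bigr => i _.
  rewrite !(derivZ, derivXn, derivMn) -mul_polyC psubstM psubstC.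
  rewrite -mulrnA mulnC -[in LHS]mulr_natl psubstM.
  by rewrite psubstXn -polyC_natr psubstC rmorph_nat mulr_natl -subn2.
rewrite tree_sum_by_roots exprS -mulrA -mulrnAr; congr (_ * _).
under eq_bigr => i _ do rewrite forest_sum_cross -mulrnAr mulrA.
rewrite -mulr_suml -psubst_deriv2 !psubstM !psubst_exp psubstX.
by rewrite /spine exprMn; ring.
Qed.

Let D := diagonal phi.

(** Splitting the pairs according to whether their last common ancestor is the
    root gives Q = G + z phi'(T) Q, where G counts those at the root. *)
Lemma tree_sum_pairs k : (0 < k)%N ->
  tree_sum p (fun a => (tree_pairs k a)%:R) =
  ((zvar R ^+ k * psubst T (phi^`() ^+ k * 'X)) *+ 2 +
  (zvar R ^+ k.-1 * psubst T (phi^`()^`() * phi^`() ^+ k.-2 * 'X ^+ 2)) *+ k.-1) * D.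
Proof.
move=> k_gt0; apply: (solve_renewal (tree_series_eq phi)).
have -> : tree_sum p (fun a => (tree_pairs k a)%:R) =
    tree_sum p (fun a => (apex_pairs k a)%:R) + tree_sum p (fun a => (pairs k a)%:R).
  by rewrite -tree_sumD; apply: eq_tree_sum => a; rewrite /tree_pairs /= addn0 natrD.
congr (_ + _); last first.
  by rewrite -tree_sumD; apply: tree_sum_additive; split=> // a b; rewrite /= !natrD.
have -> : (fun a => (apex_pairs k a)%:R) = (fun a => (tree_level k a)%:R *+ 2 +
   (if k is d.+2 then cross d a else 0)%:R) :> (forest -> R).
  by apply/funext => a; rewrite /apex_pairs natrD mulnC natrM mulr_natr.
rewrite tree_sumD tree_sumMn tree_sum_level; congr (_ *+ _ + _).
  by rewrite psubstM psubst_exp psubstX /spine exprMn mulrA.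
case: k k_gt0 => [|[|d]] // _; last exact: tree_sum_cross.
have := tree_sumMn p (fun=> 1) 0; rewrite !mulr0n => <-.
by apply: eq_tree_sum.
Qed.

End PairSums.

Section PairBound.
Variables (R : numFieldType) (phi : {poly R}).
Hypothesis phi_ge0 : forall i, 0 <= phi`_i.

Definition nonneg_coefs (q : {poly R}) := forall i, 0 <= q`_i.

Lemma nonneg_coefsM q1 q2 : nonneg_coefs q1 -> nonneg_coefs q2 -> nonneg_coefs (q1 * q2).
Proof. by move=> h1 h2 i; rewrite coefM sumr_ge0 // => j _; rewrite mulr_ge0. Qed.

Lemma nonneg_coefs1 : nonneg_coefs 1.
Proof. by move=> i; rewrite coef1 ler0n. Qed.

Lemma nonneg_coefsX q n : nonneg_coefs q -> nonneg_coefs (q ^+ n).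
Proof.
move=> h; elim: n => [|n IHn]; first exact: nonneg_coefs1.
by rewrite exprS; apply: nonneg_coefsM.
Qed.

Lemma nonneg_coefs_deriv q : nonneg_coefs q -> nonneg_coefs q^`().
Proof. by move=> h i; rewrite coef_deriv mulrn_wge0. Qed.

(** The point where integrality enters: among the m + 1 variables the average is
    at most 1 as soon as the sum s + 1 is at most m + 1. *)
Lemma coef_deriv_exp_le m s : (s <= m)%N ->
  (phi^`() * phi ^+ m)`_s <= (phi ^+ m.+1)`_s.+1.
Proof.
move=> le_sm; rewrite coef_deriv_exp ler_piMl ?nonneg_coefsX //.
by rewrite ler_pdivrMr ?ltr0n // mul1r ler_nat.
Qed.

(** One factor phi'(y) at a time is replaced by phi(y) / y: each marked child
    accounts for a unit of the sum, which keeps the average of the other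
    variables at most 1. *)
Lemma coef_spine_le psi k m : nonneg_coefs psi ->
  (psi * phi^`() ^+ k * phi ^+ m)`_m <= (psi * phi ^+ (m + k))`_(m + k).
Proof.
move=> psi_ge0; elim: k m => [|k IHk] m; first by rewrite expr0 mulr1 addn0.
rewrite addnS -addSn; apply: le_trans (IHk m.+1).
have psik_ge0 : nonneg_coefs (psi * phi^`() ^+ k).
  by apply: nonneg_coefsM => //; apply/nonneg_coefsX/nonneg_coefs_deriv.
rewrite exprSr mulrA -mulrA coefM [leRHS]coefM [leRHS]big_ord_recr /= ler_wpDr //.
  by rewrite mulr_ge0 //; apply: nonneg_coefsX.
apply: ler_sum => i _; apply: ler_wpM2l => //.
by rewrite subSn -1?ltnS // coef_deriv_exp_le // leq_subr.
Qed.

Lemma pairs_bound n k : (0 < n)%N -> (0 < k)%N ->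
  tree_sum (fun i => phi`_i) (fun a => (tree_pairs k a)%:R) n <=
  (phi ^+ n)`_n.-1 *+ 2 + ('X ^+ 2 * phi^`()^`() * phi ^+ n.-1)`_n.-1 *+ k.-1.
Proof.
move=> n_gt0 k_gt0; rewrite tree_sum_pairs // mulrDl coef_seriesD !mulrnAl !coef_seriesMn.
have phi2_ge0 : nonneg_coefs phi^`()^`().
  by do 2!apply: nonneg_coefs_deriv.
have XM_ge0 j : nonneg_coefs ('X ^+ j).
  by move=> i; rewrite coefXn ler0n.
have psi_ge0 : nonneg_coefs ('X ^+ 2 * phi^`()^`()) by apply: nonneg_coefsM.
apply: lerD.
  rewrite lerMn2r /= (lagrange_shift (tree_series_eq phi)) [_ * 'X]mulrC.
  case: leqP => [le_kn|_].
    have := @coef_spine_le 'X k (n - k) (XM_ge0 1%N).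
    by rewrite subnK // coefXM eqn0Ngt n_gt0.
  exact: nonneg_coefsX.
case: k k_gt0 => [|[|d]] //= _; rewrite lerMn2r /=.
rewrite (lagrange_shift (tree_series_eq phi)); case: (ltnP d n) => [lt_dn|_]; last first.
  exact: (nonneg_coefsM psi_ge0 (nonneg_coefsX _ phi_ge0)).
rewrite [_ * 'X ^+ 2]mulrC mulrA.
have := @coef_spine_le ('X ^+ 2 * phi^`()^`()) d (n - d.+1).
have -> : (n - d.+1 + d = n.-1)%N by lia.
by apply.
Qed.

End PairBound.

(** * The symmetric binomial kernel *)

Section CentralBinomial.

Lemma bin_central_step k :
  (k.+1 * 'C(2 * k.+1, k.+1) = 2 * (2 * k).+1 * 'C(2 * k, k))%N.
Proof.
have -> : (2 * k.+1 = (2 * k).+2)%N by lia.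
have E1 := mul_bin_diag (2 * k).+2 k.
have E2 : 'C((2 * k).+1, k.+1) = 'C((2 * k).+1, k).
  by rewrite -bin_sub; [congr 'C(_, _)|]; lia.
have E3 := mul_bin_diag (2 * k).+1 k; move: E1 E3 => /= E1 E3.
rewrite -E1 -E2; nia.
Qed.

Lemma bin_central_upper k : ('C(2 * k, k) ^ 2 * (2 * k).+1 <= 16 ^ k)%N.
Proof.
elim: k => [//|k IHk]; rewrite -(@leq_pmul2l (k.+1 ^ 2)) ?expn_gt0 //.
have E := bin_central_step k; rewrite mulnA -expnMn E !expnMn.
apply: (@leq_trans (4 * (2 * k).+1 * (2 * k.+1).+1 * 16 ^ k)%N).
  apply: leq_trans (leq_mul (leqnn _) IHk); nia.
by rewrite [(16 ^ k.+1)%N]expnS mulnA leq_mul2r; apply/orP; right; nia.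
Qed.

Lemma bin_central_lower k : (0 < k)%N -> (16 ^ k <= 4 * k * 'C(2 * k, k) ^ 2)%N.
Proof.
elim: k => // -[//|k IHk _]; have {}IHk := IHk isT; set K := k.+1 in IHk *.
rewrite -(@leq_pmul2l (K.+1 * K)) ?muln_gt0 //.
have E := bin_central_step K.
have -> : (K.+1 * K * (4 * K.+1 * 'C(2 * K.+1, K.+1) ^ 2) =
           4 * K * (K.+1 * 'C(2 * K.+1, K.+1)) ^ 2)%N by ring.
rewrite E !expnMn.
apply: (@leq_trans (4 * (2 * K).+1 ^ 2 * (4 * K * 'C(2 * K, K) ^ 2))%N); last first.
  by apply: eq_leq; ring.
apply: leq_trans (leq_mul (leqnn _) IHk).
by rewrite [(16 ^ K.+1)%N]expnS mulnA leq_mul2r; apply/orP; right; nia.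
Qed.

Lemma leq_bin_central N j : ('C(2 * N, j) <= 'C(2 * N, N))%N.
Proof.
have up i : ('C(2 * N, N + i) <= 'C(2 * N, N))%N.
  elim: i => [|i IHi]; first by rewrite addn0.
  apply: leq_trans IHi; rewrite addnS.
  have E := mul_bin_left (2 * N) (N + i).
  have [->//|nz] := posnP 'C(2 * N, (N + i).+1); nia.
have [le_Nj|lt_jN] := leqP N j; first by rewrite -(subnKC le_Nj).
rewrite -bin_sub; last by lia.
have -> : (2 * N - j = N + (N - j))%N by lia.
exact: up.
Qed.

End CentralBinomial.

Section BinomialKernel.
Variable R : realType.

(** The generating function of h times a binomial variable with parameters 2N
    and 1/2.  An even number of trials makes the centre an integer. *)
Definition binker (h N : nat) : {poly R} := (4%:R^-1 *: (1 + 'X^h) ^+ 2) ^+ N.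

Lemma binkerE h N : binker h N =
  \sum_(i < (2 * N).+1) ('C(2 * N, i)%:R / 4%:R ^+ N) *: 'X^(h * i).
Proof.
rewrite /binker exprZn -exprM exprDn scaler_sumr; apply: eq_bigr => i _.
rewrite expr1n mul1r -exprM -scalerMnr scalerMnl; congr (_ *: _).
by rewrite exprVn -mulr_natl.
Qed.

Lemma coef_binker h N j : (0 < h)%N ->
  (binker h N)`_(h * j) = 'C(2 * N, j)%:R / 4%:R ^+ N.
Proof.
move=> h_gt0; rewrite binkerE coef_sum.
have E i : (('C(2 * N, i)%:R / 4%:R ^+ N) *: 'X^(h * i))`_(h * j) =
    if i == j then 'C(2 * N, j)%:R / 4%:R ^+ N else 0 :> R.
  rewrite coefZ coefXn eqn_pmul2l // eq_sym.
  by case: eqVneq => [->|_]; rewrite ?mulr1 ?mulr0.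
under eq_bigr do rewrite E.
have [le_jN|lt_Nj] := leqP j (2 * N).
  rewrite (bigD1 (Ordinal (le_jN : j < (2 * N).+1)%N)) //= eqxx big1 ?addr0 //.
  by move=> i ne; rewrite ifF //; apply: contraNF ne => /eqP ij; apply/eqP/val_inj.
rewrite big1 ?bin_small ?mul0r // => i _; rewrite ifF //.
by apply/eqP; have := ltn_ord i; lia.
Qed.

Lemma coef_binker_ndvd h N t : ~~ (h %| t)%N -> (binker h N)`_t = 0.
Proof.
move=> ndvd; rewrite binkerE coef_sum big1 // => i _; rewrite coefZ coefXn.
rewrite (_ : (_ == _) = false) ?mulr0 //; apply: contraNF ndvd => /eqP ->.
exact: dvdn_mulr.
Qed.

Lemma binker_ge0 h N : (0 < h)%N -> nonneg_coefs (binker h N).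
Proof.
move=> h_gt0 t; have [/dvdnP[j ->]|/coef_binker_ndvd ->//] := boolP (h %| t)%N.
by rewrite mulnC coef_binker // divr_ge0 // exprn_ge0.
Qed.

(** By the arithmetic-geometric inequality b <= (u b^2 + 1/u) / 2, so that only
    b^2 <= 1/(N+1) is needed and no square root of the random N appears. *)
Lemma binker_le h N t (u : R) : (0 < h)%N -> 0 < u ->
  (binker h N)`_t <= (u / N.+1%:R + u^-1) / 2%:R.
Proof.
move=> h_gt0 u_gt0.
have rhs_ge0 : 0 <= (u / N.+1%:R + u^-1) / 2%:R.
  by rewrite divr_ge0 // addr_ge0 ?invr_ge0 ?divr_ge0 ?ltW.
have [/dvdnP[j ->]|/coef_binker_ndvd -> //] := boolP (h %| t)%N.
rewrite mulnC coef_binker //; set b := _ / _.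
have b_ge0 : 0 <= b by rewrite divr_ge0 // exprn_ge0.
have b2_le : b ^+ 2 <= N.+1%:R^-1.
  rewrite /b expr_div_n ler_pdivrMr ?exprn_gt0 //.
  rewrite mulrC ler_pdivlMr ?ltr0n // -!natrX -natrM ler_nat.
  rewrite -expnM [(N * 2)%N]mulnC expnM.
  apply: leq_trans (bin_central_upper N); apply: leq_mul; last by lia.
  by rewrite leq_exp2r // leq_bin_central.
have ub : u * b ^+ 2 <= u / N.+1%:R by rewrite ler_pM2l.
have : 0 <= u^-1 * (u * b - 1) ^+ 2 by rewrite mulr_ge0 ?sqr_ge0 // invr_ge0 ltW.
have -> : u^-1 * (u * b - 1) ^+ 2 = u * b ^+ 2 - 2%:R * b + u^-1.
  by field; rewrite gt_eqF.
move=> H; rewrite ler_pdivlMr //.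
apply: le_trans (lerD ub (lexx u^-1)); rewrite -subr_ge0.
by move: H; congr (_ <= _); ring.
Qed.

Lemma binker_central_ge N : (0 < N)%N ->
  (2%:R * Num.sqrt N%:R)^-1 <= 'C(2 * N, N)%:R / 4%:R ^+ N :> R.
Proof.
move=> N_gt0; have sN_gt0 : 0 < Num.sqrt N%:R :> R by rewrite sqrtr_gt0 ltr0n.
rewrite -(@ler_pXn2r _ 2) ?nnegrE ?invr_ge0 ?mulr_ge0 ?divr_ge0 ?exprn_ge0 //.
rewrite exprVn exprMn sqr_sqrtr // expr_div_n.
rewrite ler_pdivlMr ?exprn_gt0 // mulrC ler_pdivrMr; last first.
  by rewrite mulr_gt0 ?exprn_gt0 ?ltr0n.
have := bin_central_lower N_gt0; rewrite -(ler_nat R) => H.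
by rewrite -exprM [(N * 2)%N]mulnC exprM -!natrX -!natrM; move: H; rewrite (mulnC (4 * N)).
Qed.

(** Each of the l steps away from the centre costs a factor at least
    (N-l)/(N+l) >= exp(-4l/N). *)
Lemma bin_window N l : (0 < N)%N -> (4 * l <= N)%N ->
  'C(2 * N, N)%:R * expR (- (4%:R * l%:R ^+ 2 / N%:R)) <= 'C(2 * N, N + l)%:R :> R.
Proof.
move=> N_gt0 le_lN; have NR_gt0 : 0 < N%:R :> R by rewrite ltr0n.
suff H i : (i <= l)%N ->
    'C(2 * N, N)%:R * expR (- (4%:R * l%:R / N%:R)) ^+ i <= 'C(2 * N, N + i)%:R :> R.
  have := H l (leqnn _); rewrite -expRM_natl; congr (_ * expR _ <= _).
  by ring.
elim: i => [|i IHi] le_il; first by rewrite expr0 mulr1 addn0.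
rewrite exprSr mulrA; apply: le_trans (ler_wpM2r _ (IHi (ltnW le_il))) _.
  exact: expR_ge0.
have E := mul_bin_left (2 * N) (N + i); rewrite addnS.
have {}E : (N + i).+1%:R * 'C(2 * N, (N + i).+1)%:R = (N%:R - i%:R) * 'C(2 * N, N + i)%:R :> R.
  rewrite -natrM E natrM; congr (_ * _); rewrite -natrB; last by lia.
  by congr (_%:R); lia.
have d_gt0 : 0 < (N + i).+1%:R :> R by rewrite ltr0n.
rewrite -(ler_pM2l d_gt0) E mulrCA [leLHS]mulrC; apply: ler_wpM2r => //.
set x := 4%:R * l%:R / N%:R.
have il : i%:R + 1 <= l%:R :> R by rewrite natr1 ler_nat.
have lN : 4%:R * l%:R <= N%:R :> R by rewrite -natrM ler_nat.
have x_ge0 : 0 <= x by rewrite divr_ge0 ?mulr_ge0 ?ler0n.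
have x_le1 : x <= 1 by rewrite ler_pdivrMr // mul1r.
have ex : expR (- x) <= 1 - x / 2%:R.
  rewrite expRN -[leLHS]mul1r ler_pdivrMr ?expR_gt0 //.
  have h0 : 0 <= 1 - x / 2%:R by lra.
  have := expR_ge1Dx x; move: (expR x) => e ex1.
  have : (1 - x / 2%:R) * (1 + x) <= (1 - x / 2%:R) * e by apply: ler_wpM2l.
  nra.
apply: le_trans (ler_wpM2l (ltW d_gt0) ex) _.
have -> : x / 2%:R = 2%:R * l%:R / N%:R :> R by rewrite /x; field; rewrite gt_eqF.
rewrite -natr1 natrD mulrBr mulr1 mulrA lerBlDr -lerBlDl ler_pdivlMr //.
nra.
Qed.

Lemma binker_window h N j l : (0 < h)%N -> (0 < N)%N -> (4 * l <= N)%N ->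
  (j = N + l \/ j + l = N)%N ->
  expR (- (4%:R * l%:R ^+ 2 / N%:R)) / (2%:R * Num.sqrt N%:R) <= (binker h N)`_(h * j).
Proof.
move=> h_gt0 N_gt0 le_lN jE; rewrite coef_binker //.
have -> : 'C(2 * N, j) = 'C(2 * N, N + l).
  by case: jE => [->//|jE]; rewrite -bin_sub; [congr 'C(_, _)|]; lia.
apply: (@le_trans _ _ ('C(2 * N, N)%:R * expR (- (4%:R * l%:R ^+ 2 / N%:R)) / 4%:R ^+ N)).
  rewrite [leLHS]mulrC [leRHS]mulrAC; apply: ler_wpM2r; first exact: expR_ge0.
  exact: binker_central_ge.
by rewrite ler_wpM2r ?invr_ge0 ?exprn_ge0 // bin_window.
Qed.

End BinomialKernel.

(** * Mixtures of binomial laws *)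

Section Expectation.
Variable R : numFieldType.
Implicit Types (A B : {poly R}) (F : nat -> R).

(** The integral of F against the measure on the integers with generating
    function A. *)
Definition expect A F : R := \sum_(i < size A) A`_i * F i.

Lemma expect_wide M A F : (size A <= M)%N -> expect A F = \sum_(i < M) A`_i * F i.
Proof.
move=> leAM; rewrite /expect (big_ord_widen _ (fun i => A`_i * F i) leAM).
rewrite big_mkcond; apply: eq_bigr => i _; case: ltnP => // leAi.
by rewrite nth_default // mul0r.
Qed.

Lemma expectD A B F : expect (A + B) F = expect A F + expect B F.
Proof.
rewrite (expect_wide F (size_polyD A B)).
rewrite (@expect_wide (maxn (size A) (size B)) A) ?leq_maxl //.
rewrite (@expect_wide (maxn (size A) (size B)) B) ?leq_maxr //.
by rewrite -big_split; apply: eq_bigr => i _; rewrite coefD mulrDl.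
Qed.

Lemma expectZ c A F : expect (c *: A) F = c * expect A F.
Proof.
rewrite (expect_wide F (size_scale_leq c A)) mulr_sumr.
by apply: eq_bigr => i _; rewrite coefZ mulrA.
Qed.

Lemma expect_sum I (r : seq I) (A : I -> {poly R}) F :
  expect (\sum_(i <- r) A i) F = \sum_(i <- r) expect (A i) F.
Proof.
apply: (big_morph (fun A => expect A F)) => [A1 A2|]; first exact: expectD.
by rewrite /expect size_poly0 big_ord0.
Qed.

Lemma expect1 A : expect A (fun=> 1) = A.[1].
Proof.
by rewrite horner_coef; apply: eq_bigr => i _; rewrite expr1n.
Qed.

Lemma eq_expect A F G : F =1 G -> expect A F = expect A G.
Proof. by move=> eqFG; apply: eq_bigr => i _; rewrite eqFG. Qed.

Lemma expect_add A F G :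
  expect A (fun i => F i + G i) = expect A F + expect A G.
Proof. by rewrite -big_split; apply: eq_bigr => i _; rewrite mulrDr. Qed.

Lemma expect_mull A F c : expect A (fun i => c * F i) = c * expect A F.
Proof. by rewrite mulr_sumr; apply: eq_bigr => i _; rewrite mulrCA. Qed.

Lemma expect_cst A c : expect A (fun=> c) = c * A.[1].
Proof. by rewrite -expect1 -expect_mull; apply: eq_expect => i; rewrite mulr1. Qed.

Lemma expectXn i F : expect 'X^i F = F i.
Proof.
rewrite /expect size_polyXn big_ord_recr /= coefXn eqxx mul1r big1 ?add0r // => j _.
by rewrite coefXn ltn_eqF // mul0r.
Qed.

(** Products of generating functions are laws of independent sums. *)
Lemma expectM A B F :
  expect (A * B) F = expect A (fun i => expect B (fun j => F (i + j)%N)).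
Proof.
rewrite mul_poly_sum expect_sum; apply: eq_bigr => i _; rewrite expectZ; congr (_ * _).
rewrite (@expect_wide (i + size B)); last first.
  by apply: leq_trans (size_polyMleq _ _) _; rewrite size_polyXn.
rewrite big_split_ord /= big1 ?add0r => [|j _]; last by rewrite coefXnM ltn_ord mul0r.
by apply: eq_bigr => j _; rewrite coefXnM ltnNge leq_addr addKn.
Qed.

Lemma ler_expect A F G : nonneg_coefs A ->
  (forall i, A`_i != 0 -> F i <= G i) -> expect A F <= expect A G.
Proof.
move=> A_ge0 leFG; apply: ler_sum => i _.
by have [->|/leFG le] := eqVneq A`_i 0; rewrite ?mul0r // ler_wpM2l.
Qed.

Lemma coefM_expect A B t :
  (A * B)`_t = expect A (fun i => if (i <= t)%N then B`_(t - i) else 0).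
Proof.
rewrite mul_poly_sum coef_sum; apply: eq_bigr => i _.
by rewrite coefZ coefXnM /= [(i <= t)%N]leqNgt; case: (t < i)%N.
Qed.

Lemma coefM_le A B t u : nonneg_coefs A -> 0 <= u -> (forall i, B`_i <= u) ->
  (A * B)`_t <= A.[1] * u.
Proof.
move=> A_ge0 u_ge0 leBu; rewrite coefM_expect mulrC -expect_cst.
by apply: ler_expect => // i _; case: ifP.
Qed.

Lemma horner1_ge0 A : nonneg_coefs A -> 0 <= A.[1].
Proof.
by move=> A_ge0; rewrite -expect1 sumr_ge0 // => i _; rewrite mulr1.
Qed.

Lemma coef_le_horner1 A i : nonneg_coefs A -> A`_i <= A.[1].
Proof.
move=> A_ge0; have := @coefM_le A 1 i 1 A_ge0 ler01.
by rewrite !mulr1; apply=> j; rewrite coef1; case: (j == 0%N).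
Qed.

End Expectation.

(** At distance l from the centre, where l^2 <= 2(Q+1)n, and with
    N >= rho n / (8m), the exponent 4 l^2 / N of [bin_window] is at most
    64 (Q+1) m / rho. *)
Definition lower_constant (R : realType) (rho Q : R) m : R :=
  expR (- (64%:R * (Q + 1) * m%:R / rho)) / 2%:R.

(** A pointwise form of a union bound: the right factor is positive only if the
    centre a + hN is within sqrt(Q n) of n and N + 1 > rho (q+1) / 4, and then it
    is at most 1.  Summing over a and N replaces any discussion of good and bad
    events.  The two lower bounds on n place the target well inside the range
    where [bin_window] applies. *)
Lemma binker_pointwise (R : realType) (rho Q : R) h m n q r N a :
  0 < rho -> 0 < Q -> (0 < h)%N -> n = (m * q + r)%N -> (r < m)%N ->
  8%:R * m%:R / rho <= n%:R -> 2048%:R * (Q + 1) * m%:R ^+ 2 / rho ^+ 2 <= n%:R ->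
  (N <= q)%N -> (0 < n)%N ->
  (h %| n.-1)%N -> (h %| a)%N ->
  lower_constant rho Q m / Num.sqrt n%:R *
    (1 - (a%:R + h%:R * N%:R - n%:R) ^+ 2 / (Q * n%:R) -
     rho / 4%:R * q.+1%:R / N.+1%:R) <=
  (if (a <= n.-1)%N then (binker R h N)`_(n.-1 - a) else 0).
Proof.
move=> rho_gt0 Q_gt0 h_gt0 nE lt_rm n_large1 n_large2 le_Nq n_gt0 dvd_n dvd_a.
have x_gt0 : 0 < n%:R :> R by rewrite ltr0n.
have lc_gt0 : 0 < lower_constant rho Q m by rewrite divr_gt0 ?expR_gt0.
have m_gt0 : 0 < m%:R :> R by rewrite ltr0n; apply: leq_ltn_trans lt_rm.
set d := a%:R + h%:R * N%:R - n%:R.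
set brk := (X in _ * X); set v := (X in _ <= X).
have v_ge0 : 0 <= v by rewrite /v; case: ifP => // _; apply: binker_ge0.
have [brk_le0|brk_gt0] := leP brk 0.
  by apply: le_trans v_ge0; rewrite mulr_ge0_le0 // divr_ge0 ?sqrtr_ge0 // ltW.
have brkE : d ^+ 2 / (Q * n%:R) + rho / 4%:R * q.+1%:R / N.+1%:R < 1.
  by move: brk_gt0; rewrite /brk -addrA -opprD subr_gt0.
have d2_ge0 : 0 <= d ^+ 2 / (Q * n%:R) by rewrite divr_ge0 ?sqr_ge0 // ltW // mulr_gt0.
have N1_gt0 : 0 < N.+1%:R :> R by rewrite ltr0n.
have w_ge0 : 0 <= rho / 4%:R * q.+1%:R / N.+1%:R.
  by rewrite !mulr_ge0 ?invr_ge0 // ltW.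
have d2_lt : d ^+ 2 < Q * n%:R.
  have : d ^+ 2 / (Q * n%:R) < 1 by apply: le_lt_trans brkE; rewrite lerDl.
  by rewrite ltr_pdivrMr ?mulr_gt0 // mul1r.
have w_lt : rho / 4%:R * q.+1%:R < N.+1%:R.
  have : rho / 4%:R * q.+1%:R / N.+1%:R < 1 by apply: le_lt_trans brkE; rewrite lerDr.
  by rewrite ltr_pdivrMr // mul1r.
have brk_le1 : brk <= 1 by rewrite /brk -addrA -opprD gerBl addr_ge0.
have qm : n%:R <= m%:R * q.+1%:R :> R.
  by rewrite -natrM ler_nat nE mulnS addnC leq_add2r ltnW.
have n1 : 8%:R * m%:R <= rho * n%:R by rewrite [leRHS]mulrC -ler_pdivrMr.
have n2 : 2048%:R * (Q + 1) * m%:R ^+ 2 <= rho ^+ 2 * n%:R.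
  by rewrite [leRHS]mulrC -ler_pdivrMr ?exprn_gt0.
have mN : rho * n%:R / 8%:R <= m%:R * N%:R.
  have : rho / 4%:R * n%:R <= m%:R * N.+1%:R.
    apply: (@le_trans _ _ (m%:R * (rho / 4%:R * q.+1%:R))).
      by rewrite mulrCA ler_wpM2l // divr_ge0 // ltW.
    by rewrite ler_wpM2l // ltW.
  by rewrite -[N.+1%:R]natr1 mulrDr mulr1; move: n1; clear; lra.
have n_ge1 : 1 <= n%:R :> R by rewrite ler1n.
have d1_le : (d + 1) ^+ 2 <= 2%:R * (Q + 1) * n%:R.
  have := sqr_ge0 (d - 1); move: (d) d2_lt n_ge1; clear => e; rewrite !expr2; nra.
(* this is 16 times the bound on (d + 1)^2, so that 4 l <= N below *)
have N2 : 32%:R * (Q + 1) * n%:R <= N%:R ^+ 2.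
  rewrite -(ler_pM2l (exprn_gt0 2 m_gt0)) -exprMn.
  apply: (@le_trans _ _ ((rho * n%:R / 8%:R) ^+ 2)); last first.
    by rewrite ler_pXn2r ?nnegrE ?mulr_ge0 ?invr_ge0 ?ler0n // ltW.
  have -> : (rho * n%:R / 8%:R) ^+ 2 = rho ^+ 2 * n%:R * n%:R / 64%:R by field.
  rewrite ler_pdivlMr //; apply: le_trans (ler_wpM2r (ltW x_gt0) n2).
  by rewrite le_eqVlt; apply/orP; left; apply/eqP; ring.
have N_gt0 : (0 < N)%N.
  rewrite lt0n; apply/eqP => N0; move: N2; rewrite N0 expr0n /=.
  by rewrite leNgt !mulr_gt0 // addr_gt0.
have NR_gt0 : 0 < N%:R :> R by rewrite ltr0n.
have h_ge1 : 1 <= h%:R :> R by rewrite ler1n.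
have n1E : n.-1%:R = n%:R - 1 :> R by rewrite -subn1 natrB.
(* if a > n - 1, the centre exceeds the target by at least N, which is too much *)
rewrite /v; case: leqP => [le_a|lt_a]; last first.
  have : n%:R <= a%:R :> R by rewrite ler_nat -(prednK n_gt0).
  have : N%:R <= h%:R * N%:R :> R by rewrite ler_peMl.
  move=> hN na; have : N%:R ^+ 2 <= (d + 1) ^+ 2.
    have N_le : N%:R <= d + 1 by move: hN na; rewrite /d; clear; lra.
    by rewrite ler_pXn2r ?nnegrE // (le_trans _ N_le).
  move: N2 d1_le; set y := (Q + 1) * n%:R; have y_gt0 : 0 < y by rewrite mulr_gt0 // addr_gt0.
  by rewrite -!mulrA -/y; move: y_gt0; clearbody y; clear; lra.
have /dvdnP[j jE] : (h %| n.-1 - a)%N by rewrite dvdn_sub.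
have [l jl] : exists l, (j = N + l \/ j + l = N)%N.
  case: (leqP N j) => [le|/ltnW le]; [exists (j - N)%N; left|exists (N - j)%N; right].
    by rewrite subnKC.
  by rewrite subnKC.
have ajE : a%:R + h%:R * j%:R = n%:R - 1 :> R.
  by rewrite -n1E -natrM -natrD [(h * j)%N]mulnC -jE subnKC.
have hl : (h%:R * l%:R) ^+ 2 = (d + 1) ^+ 2 :> R.
  rewrite /d -[RHS]sqrrN; case: jl => [jl|jl].
    congr (_ ^+ 2); move: ajE; rewrite jl natrD; clear; lra.
  rewrite -[RHS]sqrrN; congr (_ ^+ 2); move: ajE; rewrite -jl natrD; clear; lra.
have l2 : l%:R ^+ 2 <= 2%:R * (Q + 1) * n%:R :> R.
  apply: le_trans d1_le; rewrite -hl ler_pXn2r ?nnegrE ?mulr_ge0 //.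
  by rewrite ler_peMl.
have l4 : (4 * l <= N)%N.
  rewrite -(ler_nat R) -(@ler_pXn2r _ 2) ?nnegrE // natrM exprMn.
  apply: le_trans N2; move: l2; clear; lra.
apply: (@le_trans _ _ (lower_constant rho Q m / Num.sqrt n%:R)).
  by rewrite ler_piMr // divr_ge0 ?sqrtr_ge0 // ltW.
rewrite jE [(j * h)%N]mulnC; apply: le_trans (binker_window R h_gt0 N_gt0 l4 jl).
rewrite /lower_constant -mulrA -invfM; apply: ler_pM.
- exact: expR_ge0.
- by rewrite invr_ge0 mulr_ge0 ?sqrtr_ge0.
- rewrite ler_expR lerN2 ler_pdivrMr //.
  have -> : 64%:R * (Q + 1) * m%:R / rho * N%:R =
     64%:R * (Q + 1) / rho * (m%:R * N%:R) by ring.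
  apply: (@le_trans _ _ (64%:R * (Q + 1) / rho * (rho * n%:R / 8%:R))); last first.
    by rewrite ler_wpM2l // divr_ge0 ?mulr_ge0 ?addr_ge0 // ltW.
  have -> : 64%:R * (Q + 1) / rho * (rho * n%:R / 8%:R) = 8%:R * (Q + 1) * n%:R.
    by field; rewrite gt_eqF.
  by move: l2; clear; lra.
rewrite lef_pV2 ?posrE ?mulr_gt0 ?sqrtr_gt0 // ler_pM2l // ler_sqrt // ler_nat nE.
apply: leq_trans le_Nq _; apply: leq_trans (leq_addr _ _).
by rewrite leq_pmull // (leq_ltn_trans _ lt_rm).
Qed.

Section Mixture.
Variables (R : realType) (phi G : {poly R}) (rho : R) (m s h : nat).
Hypotheses (phi_ge0 : nonneg_coefs phi) (G_ge0 : nonneg_coefs G).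
Hypotheses (rho_gt0 : 0 < rho) (h_gt0 : (0 < h)%N).
Hypothesis (phi_mass : phi.[1] <= 1).
Hypothesis block_eq : phi ^+ m = rho *: ('X^s * binker R h 1) + G.

(** The part of the law of a sum of m q + r offspring numbers on which exactly
    N of the q blocks of length m use their binomial component, with the values
    of these N components left out. *)
Definition mixing q r N : {poly R} :=
  (rho ^+ N *: 'X^(s * N)) * G ^+ (q - N) * phi ^+ r *+ 'C(q, N).

Lemma expansion q r :
  phi ^+ (m * q + r) = \sum_(N < q.+1) mixing q r N * binker R h N.
Proof.
rewrite exprD exprM block_eq addrC exprDn mulr_suml; apply: eq_bigr => N _.
rewrite /mixing !mulrnAl; congr (_ *+ _).
rewrite exprZn exprMn -exprM {1}/binker expr1 -/(binker R h N).
by rewrite -!mul_polyC; ring.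
Qed.

Lemma mixing_ge0 q r N : nonneg_coefs (mixing q r N).
Proof.
move=> i; rewrite coefMn mulrn_wge0 //.
apply: nonneg_coefsM; last exact: nonneg_coefsX.
apply: nonneg_coefsM; last exact: nonneg_coefsX.
by move=> j; rewrite coefZ coefXn mulr_ge0 // exprn_ge0 // ltW.
Qed.

Lemma horner_binker N : (binker R h N).[1] = 1.
Proof.
rewrite /binker horner_exp hornerZ horner_exp hornerD hornerC hornerXn expr1n.
by rewrite (_ : 4%:R^-1 * _ = 1) ?expr1n //; field.
Qed.

Lemma sum_mixing_mass q r :
  \sum_(N < q.+1) (mixing q r N).[1] = phi.[1] ^+ (m * q + r).
Proof.
rewrite -horner_exp expansion horner_sum; apply: eq_bigr => N _.
by rewrite hornerM horner_binker mulr1.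
Qed.

Lemma block_mass : rho + G.[1] <= 1.
Proof.
have -> : rho + G.[1] = phi.[1] ^+ m.
  rewrite -horner_exp block_eq hornerD hornerZ hornerM hornerXn horner_binker.
  by rewrite expr1n !mulr1.
by rewrite exprn_ile1 // horner1_ge0.
Qed.

(** For a binomial number N of successes, C(q,N)/(N+1) = C(q+1,N+1)/(q+1)
    gives E[1/(N+1)] <= 1/((q+1) rho). *)
Lemma mixing_inv_mean q r :
  \sum_(N < q.+1) (mixing q r N).[1] / N.+1%:R <= (q.+1%:R * rho)^-1.
Proof.
have q1_gt0 : 0 < q.+1%:R :> R by rewrite ltr0n.
have G1_ge0 : 0 <= G.[1] by apply: horner1_ge0.
rewrite -[leRHS]mul1r ler_pdivlMr ?mulr_gt0 // mulr_suml.
apply: le_trans (_ : (rho + G.[1]) ^+ q.+1 <= 1); last first.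
  by rewrite exprn_ile1 ?block_mass // addr_ge0 // ltW.
rewrite [rho + _]addrC exprDn [leRHS]big_ord_recl.
rewrite [leRHS]addrC ler_wpDr //; first by rewrite mulrn_wge0 // mulr_ge0 ?exprn_ge0 ?(ltW rho_gt0).
apply: ler_sum => N _; rewrite /mixing hornerMn !hornerM hornerZ hornerXn !horner_exp expr1n mulr1.
rewrite /= /bump /= add1n subSS.
set a := G.[1] ^+ (q - N); have a_ge0 : 0 <= a by apply: exprn_ge0.
have ph : phi.[1] ^+ r <= 1 by rewrite exprn_ile1 // horner1_ge0.
rewrite -[_ *+ 'C(q, N)]mulr_natr -[_ *+ 'C(q.+1, N.+1)]mulr_natr.
have -> : 'C(q.+1, N.+1)%:R = q.+1%:R / N.+1%:R * 'C(q, N)%:R :> R.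
  apply: (mulfI (x := N.+1%:R)); first by rewrite pnatr_eq0.
  by rewrite -natrM -mul_bin_diag natrM /=; field; rewrite addrC natr1 pnatr_eq0.
pose c : R := 'C(q, N)%:R; pose d : R := N.+1%:R^-1; rewrite -/c -/d exprSr.
have -> : rho ^+ N * a * phi.[1] ^+ r * c * d * (q.+1%:R * rho) =
  (a * (rho ^+ N * rho) * (q.+1%:R * d * c)) * phi.[1] ^+ r by ring.
have r_ge0 := ltW rho_gt0.
by rewrite ler_piMr // !mulr_ge0 ?exprn_ge0 ?ler0n ?invr_ge0 ?ler0n.
Qed.

(** The maximum of a binomial law is averaged over N, with the free parameter
    of [binker_le] taken to be sqrt(q+1). *)
Lemma coef_upper q r t :
  (phi ^+ (m * q + r))`_t <= (rho^-1 + 1) / (2%:R * Num.sqrt q.+1%:R).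
Proof.
set u := Num.sqrt _; have u_gt0 : 0 < u by rewrite sqrtr_gt0 ltr0n.
rewrite expansion coef_sum.
apply: (@le_trans _ _ (\sum_(N < q.+1) (mixing q r N).[1] * ((u / N.+1%:R + u^-1) / 2%:R))).
  apply: ler_sum => N _; apply: coefM_le; first exact: mixing_ge0.
    by rewrite divr_ge0 // addr_ge0 ?divr_ge0 ?invr_ge0 // ltW.
  by move=> i; apply: binker_le.
have -> : \sum_(N < q.+1) (mixing q r N).[1] * ((u / N.+1%:R + u^-1) / 2%:R) =
  u / 2%:R * (\sum_(N < q.+1) (mixing q r N).[1] / N.+1%:R) +
  u^-1 / 2%:R * (\sum_(N < q.+1) (mixing q r N).[1]).
  rewrite !mulr_sumr -big_split; apply: eq_bigr => N _ /=; ring.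
have mass_le1 : phi.[1] ^+ (m * q + r) <= 1 by rewrite exprn_ile1 // horner1_ge0.
have := mixing_inv_mean q r; rewrite sum_mixing_mass.
have -> : q.+1%:R = u ^+ 2 :> R by rewrite sqr_sqrtr.
move=> inv_le; apply: (@le_trans _ _ (u / 2%:R * (u ^+ 2 * rho)^-1 + u^-1 / 2%:R * 1)).
  by apply: lerD; apply: ler_wpM2l => //; rewrite divr_ge0 ?invr_ge0 // ltW.
by rewrite le_eqVlt; apply/orP; left; apply/eqP; field; rewrite !gt_eqF.
Qed.

Lemma expect_binker N : expect (binker R h N) (fun j => j%:R) = h%:R * N%:R.
Proof.
have binkerS k : binker R h k.+1 = binker R h 1 * binker R h k.
  by rewrite /binker expr1 exprS.
have b1 : expect (binker R h 1) (fun j => j%:R) = h%:R.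
  rewrite /binker expr1 expectZ sqrrD expr1n mul1r -exprM -(expr0 'X) mulr2n.
  by rewrite !expectD !expectXn muln2 -addnn natrD; field.
elim: N => [|N IHN]; first by rewrite /binker expr0 -(expr0 'X) expectXn mulr0.
rewrite binkerS expectM.
under eq_expect => i do under eq_expect => j do rewrite natrD.
under eq_expect => i do rewrite expect_add expect_cst horner_binker mulr1 IHN.
by rewrite expect_add b1 expect_cst horner_binker -natr1; ring.
Qed.

(** Jensen's inequality for the square, in the form
    (c+j)^2 >= 2d(c+j) - d^2. *)
Lemma binker_jensen N c : (c + h%:R * N%:R) ^+ 2 <=
  expect (binker R h N) (fun j => (c + j%:R) ^+ 2).
Proof.
set d := _ + _.
apply: (@le_trans _ _ (expect (binker R h N)
  (fun j => (2%:R * d * c - d ^+ 2) + 2%:R * d * j%:R))).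
  by rewrite expect_add expect_cst expect_mull expect_binker horner_binker /d; lra.
apply: ler_expect => [|j _]; first exact: binker_ge0.
by rewrite -subr_ge0; have := sqr_ge0 (d - (c + j%:R)); congr (_ <= _); ring.
Qed.

(** Taking the conditional expectation given the number of binomial blocks and
    the other variables does not increase the second moment. *)
Lemma mixing_second_moment q r c :
  \sum_(N < q.+1) expect (mixing q r N) (fun a => (a%:R + h%:R * N%:R - c) ^+ 2) <=
  expect (phi ^+ (m * q + r)) (fun i => (i%:R - c) ^+ 2).
Proof.
rewrite expansion expect_sum; apply: ler_sum => N _; rewrite expectM.
apply: ler_expect => [|a _]; first exact: mixing_ge0.
apply: le_trans (_ : _ <= expect _ (fun j => ((a%:R - c) + j%:R) ^+ 2)) _.
  by rewrite addrAC; apply: binker_jensen.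
by apply: ler_expect => [|j _]; [exact: binker_ge0|rewrite natrD addrAC].
Qed.

Definition lattice_coefs (A : {poly R}) := forall i, A`_i != 0 -> (h %| i)%N.

Lemma lattice_coefsM A B : lattice_coefs A -> lattice_coefs B -> lattice_coefs (A * B).
Proof.
move=> hA hB i; apply: contraNT => ndvd; rewrite coefM big1 // => j _.
have [->|/hA dA] := eqVneq A`_j 0; first by rewrite mul0r.
have [->|/hB dB] := eqVneq B`_(i - j) 0; first by rewrite mulr0.
by case/negP: ndvd; rewrite -(subnKC (_ : j <= i)%N) ?dvdn_add // -ltnS.
Qed.

Lemma lattice_coefsX A n : lattice_coefs A -> lattice_coefs (A ^+ n).
Proof.
move=> hA; elim: n => [|n IHn]; last by rewrite exprS; apply: lattice_coefsM.
by move=> i; rewrite coef1; case: i => //= i; rewrite eqxx.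
Qed.

Hypothesis phi_lattice : lattice_coefs phi.

(** The remainder G and the shift s live on the lattice because nothing cancels
    in the sum of nonnegative polynomials that makes up phi^m. *)
Lemma mixing_lattice q r N : lattice_coefs (mixing q r N).
Proof.
have bk_ge0 := binker_ge0 R 1 h_gt0.
have Xs_ge0 : nonneg_coefs ('X^s * binker R h 1).
  by apply: nonneg_coefsM => // i; rewrite coefXn ler0n.
have dvd_m i : (phi ^+ m)`_i != 0 -> (h %| i)%N by apply: lattice_coefsX.
have dvd_s : (h %| s)%N.
  apply: dvd_m; rewrite block_eq coefD coefZ coefXnM.
  rewrite ltnn subnn -(muln0 h) coef_binker // bin0 gt_eqF //.
  by rewrite ltr_wpDr // mulr_gt0 // divr_gt0 // exprn_gt0.
have G_lattice : lattice_coefs G.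
  move=> i nz; apply: dvd_m.
  rewrite block_eq coefD coefZ gt_eqF // ltr_wpDl ?mulr_ge0 ?(ltW rho_gt0) //.
  by rewrite lt_neqAle eq_sym nz G_ge0.
move=> i; rewrite /mixing coefMn => nz.
have : (rho ^+ N *: 'X^(s * N) * G ^+ (q - N) * phi ^+ r)`_i != 0.
  by apply: contraNneq nz => ->; rewrite mul0rn.
apply: lattice_coefsM; last exact: lattice_coefsX.
apply: lattice_coefsM; last exact: lattice_coefsX.
move=> j; rewrite coefZ coefXn; case: (j =P _) => [->|]; last by rewrite mulr0 eqxx.
by move=> _; apply: dvdn_mulr.
Qed.

Variable V : R.
Hypothesis V_ge0 : 0 <= V.

Let Q := 4%:R * (V + 1).

(** In the sum of [binker_pointwise] against the law of (a, N), the total mass is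
    at least 3/4; Chebyshev's inequality bounds the second term by 1/4, and
    [mixing_inv_mean] bounds the third by 1/4. *)
Lemma coef_lower n :
  8%:R * m%:R / rho <= n%:R -> 2048%:R * (Q + 1) * m%:R ^+ 2 / rho ^+ 2 <= n%:R ->
  (0 < m)%N -> (0 < n)%N -> (h %| n.-1)%N ->
  3%:R / 4%:R <= phi.[1] ^+ n ->
  expect (phi ^+ n) (fun i => (i%:R - n%:R) ^+ 2) <= n%:R * V + 1 ->
  lower_constant rho Q m / 4%:R / Num.sqrt n%:R <= (phi ^+ n)`_n.-1.
Proof.
move=> n_large1 n_large2 m_gt0 n_gt0 dvd_n mass second.
pose q := (n %/ m)%N; pose r := (n %% m)%N.
have nE : n = (m * q + r)%N by rewrite mulnC -divn_eq.
have lt_rm : (r < m)%N by rewrite ltn_mod.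
have x_gt0 : 0 < n%:R :> R by rewrite ltr0n.
have n_ge1 : 1 <= n%:R :> R by rewrite ler1n.
have V1_gt0 : 0 < V + 1 by rewrite ltr_wpDl.
have Q_gt0 : 0 < Q by rewrite /Q mulr_gt0.
have lc_gt0 : 0 < lower_constant rho Q m by rewrite divr_gt0 ?expR_gt0.
have -> : (phi ^+ n)`_n.-1 = \sum_(N < q.+1) (mixing q r N * binker R h N)`_n.-1.
  by rewrite {1}nE expansion coef_sum.
have s_gt0 : 0 < Num.sqrt n%:R :> R by rewrite sqrtr_gt0.
set k := lower_constant rho Q m / Num.sqrt n%:R; have k_gt0 : 0 < k by rewrite divr_gt0.
apply: (@le_trans _ _ (\sum_(N < q.+1) k *
  ((mixing q r N).[1] -
   expect (mixing q r N) (fun a => (a%:R + h%:R * N%:R - n%:R) ^+ 2) / (Q * n%:R) -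
   rho / 4%:R * q.+1%:R * ((mixing q r N).[1] / N.+1%:R)))); last first.
  apply: ler_sum => N _; rewrite coefM_expect.
  apply: (@le_trans _ _ (expect (mixing q r N) (fun a => k *
    (1 - (a%:R + h%:R * N%:R - n%:R) ^+ 2 / (Q * n%:R) -
     rho / 4%:R * q.+1%:R / N.+1%:R)))).
    rewrite expect_mull; apply: ler_wpM2l; first exact: ltW.
    have -> : expect (mixing q r N) (fun a =>
       1 - (a%:R + h%:R * N%:R - n%:R) ^+ 2 / (Q * n%:R) -
       rho / 4%:R * q.+1%:R / N.+1%:R) =
      expect (mixing q r N) (fun a =>
       (1 - rho / 4%:R * q.+1%:R / N.+1%:R) +
       (- (Q * n%:R)^-1) * (a%:R + h%:R * N%:R - n%:R) ^+ 2).
      by apply: eq_expect => a; ring.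
    rewrite expect_add expect_cst expect_mull le_eqVlt; apply/orP; left; apply/eqP; ring.
  apply: ler_expect => [|a nz]; first exact: mixing_ge0.
  apply: (@binker_pointwise R rho Q h m n q r N a) => //; first by rewrite -ltnS.
  exact: mixing_lattice nz.
rewrite -mulr_sumr.
have -> : lower_constant rho Q m / 4%:R / Num.sqrt n%:R = k * 4%:R^-1 by rewrite /k mulrAC.
rewrite ler_pM2l // !sumrB -mulr_suml -mulr_sumr sum_mixing_mass -nE.
have t1 : (\sum_(N < q.+1) expect (mixing q r N)
    (fun a => (a%:R + h%:R * N%:R - n%:R) ^+ 2)) / (Q * n%:R) <= 4%:R^-1.
  rewrite ler_pdivrMr ?mulr_gt0 //; apply: le_trans (mixing_second_moment q r n%:R) _.
  rewrite -nE; apply: le_trans second _; rewrite /Q; nra.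
have t2 : rho / 4%:R * q.+1%:R * (\sum_(N < q.+1) (mixing q r N).[1] / N.+1%:R) <= 4%:R^-1.
  have q_gt0 : 0 < q.+1%:R :> R by rewrite ltr0n.
  have := mixing_inv_mean q r; rewrite -(@ler_pM2l _ (rho / 4%:R * q.+1%:R)).
    have -> : rho / 4%:R * q.+1%:R * (q.+1%:R * rho)^-1 = 4%:R^-1; last by [].
    by field; rewrite ?gt_eqF.
  by rewrite !mulr_gt0 // invr_gt0.
by move: mass t1 t2; lra.
Qed.

End Mixture.

(** * The offspring law and its lattice *)

Section Moments.
Variables (R : realType) (phi : {poly R}) (V delta : R).
Hypotheses (phi_ge0 : nonneg_coefs phi) (phi_mass : phi.[1] <= 1).
Hypothesis first_moment : `|expect phi (fun i => i%:R - 1)| <= delta.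
Hypothesis second_moment : expect phi (fun i => (i%:R - 1) ^+ 2) <= V.

(** The law may have mass less than 1 and mean slightly off 1, as it does after
    truncation; the errors add up to n delta, which is harmless when delta is
    at most 1/n. *)
Lemma moments_exp n :
  `|expect (phi ^+ n) (fun i => i%:R - n%:R)| <= n%:R * delta /\
  expect (phi ^+ n) (fun i => (i%:R - n%:R) ^+ 2) <= n%:R * V + (n%:R * delta) ^+ 2.
Proof.
have mass_ge0 : 0 <= phi.[1] by apply: horner1_ge0.
elim: n => [|n [IH1 IH2]].
  rewrite expr0 -(expr0 'X) !expectXn subrr !mul0r normr0 expr0n /= addr0.
  by split.
have mass_n : 0 <= (phi ^+ n).[1] <= 1.
  by rewrite horner_exp exprn_ge0 //= exprn_ile1.
have [e1_le s1_le] := (first_moment, second_moment).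
set e1 := expect phi _ in e1_le; set s1 := expect phi _ in s1_le.
set en := expect (phi ^+ n) _ in IH1; set sn := expect (phi ^+ n) _ in IH2.
have -> : expect (phi ^+ n.+1) (fun i => i%:R - n.+1%:R) =
    e1 * (phi ^+ n).[1] + phi.[1] * en.
  rewrite exprS expectM mulrC -expect_mull -[X in _ + X]mulrC -expect_cst -expect_add.
  apply: eq_expect => i; rewrite mulrC -expect_cst -expect_add; apply: eq_expect => j.
  by rewrite natrD -natr1; ring.
have -> : expect (phi ^+ n.+1) (fun i => (i%:R - n.+1%:R) ^+ 2) =
    s1 * (phi ^+ n).[1] + 2%:R * e1 * en + phi.[1] * sn.
  rewrite exprS expectM.
  transitivity (expect phi (fun i => (phi ^+ n).[1] * (i%:R - 1) ^+ 2 +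
      (2%:R * en) * (i%:R - 1) + sn)).
    apply: eq_expect => i; rewrite -[2%:R * en * _]mulrAC.
    rewrite mulrC -expect_cst -/sn -expect_mull -!expect_add.
    by apply: eq_expect => j; rewrite natrD -natr1; ring.
  by rewrite !expect_add !expect_mull expect_cst -/e1 -/s1; ring.
have s1_ge0 : 0 <= s1 by apply: sumr_ge0 => i _; rewrite mulr_ge0 ?sqr_ge0.
have sn_ge0 : 0 <= sn.
  by apply: sumr_ge0 => i _; rewrite mulr_ge0 ?sqr_ge0 //; apply: nonneg_coefsX.
case/andP: mass_n => mn_ge0 mn_le1; split.
  apply: le_trans (ler_normD _ _) _; rewrite !normrM (ger0_norm mn_ge0) (ger0_norm mass_ge0).
  rewrite -natr1 mulrDl mul1r addrC; apply: lerD.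
    by apply: le_trans IH1; rewrite ler_piMl.
  by apply: le_trans e1_le; rewrite ler_piMr.
have cross_le : e1 * en <= delta * (n%:R * delta).
  apply: le_trans (ler_norm _) _; rewrite normrM; exact: ler_pM.
have t1 : s1 * (phi ^+ n).[1] <= V by apply: le_trans s1_le; rewrite ler_piMr.
have t2 : phi.[1] * sn <= n%:R * V + (n%:R * delta) ^+ 2.
  by apply: le_trans IH2; rewrite ler_piMl.
have := sqr_ge0 delta; rewrite -[n.+1%:R]natr1 !mulrDl !mul1r sqrrD.
by move: t1 t2 cross_le; lra.
Qed.

End Moments.

Section Truncation.
Variables (R : realType) (p : nat -> R).
Hypothesis p_ge0 : forall x, 0 <= p x.

Definition truncation M : {poly R} := \poly_(x < M) p x.

Lemma truncation_ge0 M : nonneg_coefs (truncation M).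
Proof. by move=> i; rewrite coef_poly; case: ifP. Qed.

Lemma expect_truncation M F : expect (truncation M) F = \sum_(x < M) p x * F x.
Proof.
rewrite (expect_wide F (size_poly _ _)); apply: eq_bigr => i _.
by rewrite coef_poly ltn_ord.
Qed.

Lemma coef_truncation_exp M n t : (t < M)%N ->
  (truncation M ^+ n)`_t = (truncation t.+1 ^+ n)`_t.
Proof.
elim: n M t => [|n IHn] M t lt_tM; first by rewrite !expr0.
rewrite !exprS !coefM; apply: eq_bigr => -[i lt_it] _ /=.
rewrite !coef_poly lt_it (leq_trans lt_it lt_tM); congr (_ * _).
rewrite IHn ?(leq_ltn_trans (leq_subr _ _)) //.
by rewrite [RHS]IHn // ltnS leq_subr.
Qed.

Lemma ler_coef_truncation_exp M M' n t : (M <= M')%N ->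
  (truncation M ^+ n)`_t <= (truncation M' ^+ n)`_t.
Proof.
move=> leMM'; elim: n t => [|n IHn] t; first by rewrite !expr0.
rewrite !exprS !coefM; apply: ler_sum => i _; apply: ler_pM => //.
- exact: truncation_ge0.
- exact: (nonneg_coefsX n (truncation_ge0 M)).
rewrite !coef_poly; case: ifP => [lt|_]; first by rewrite (leq_trans lt leMM').
by case: ifP.
Qed.

Lemma coefM_gt0 (A B : {poly R}) i j : nonneg_coefs A -> nonneg_coefs B ->
  0 < A`_i -> 0 < B`_j -> 0 < (A * B)`_(i + j).
Proof.
move=> A_ge0 B_ge0 Ai Bj; rewrite coefM.
rewrite (bigD1 (Ordinal (leq_addr j i : i < (i + j).+1)%N)) //= addKn.
by rewrite ltr_wpDr ?mulr_gt0 // sumr_ge0 // => k _; rewrite mulr_ge0.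
Qed.

Lemma coefX_gt0 (A : {poly R}) i k : nonneg_coefs A -> 0 < A`_i -> 0 < (A ^+ k)`_(k * i).
Proof.
move=> A_ge0 Ai; elim: k => [|k IHk]; first by rewrite expr0 coef1.
by rewrite exprS mulSn; apply: coefM_gt0 => //; apply: nonneg_coefsX.
Qed.

(** The differences d of two possible values of some S_m; by subtracting
    multiples, Euclid's algorithm shows that they are the multiples of the span
    of the lattice. *)
Definition reachable_gap d := exists M m s,
  0 < (truncation M ^+ m)`_s /\ 0 < (truncation M ^+ m)`_(s + d).

Lemma reachable_gap_modn d e : reachable_gap d -> reachable_gap e ->
  reachable_gap (d %% e)%N.
Proof.
move=> [M1 [m1 [s1 [lo1 hi1]]]] [M2 [m2 [s2 [lo2 hi2]]]].
(* k copies of the second gap are put below the first one, and taken off above *)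
pose k := (d %/ e)%N; exists (maxn M1 M2), (m1 + m2 * k)%N, (s1 + k * (s2 + e))%N.
have up1 t : 0 < (truncation M1 ^+ m1)`_t -> 0 < (truncation (maxn M1 M2) ^+ m1)`_t.
  by move=> pos; apply: lt_le_trans pos (ler_coef_truncation_exp _ _ (leq_maxl _ _)).
have up2 t : 0 < (truncation M2 ^+ m2)`_t -> 0 < (truncation (maxn M1 M2) ^+ m2)`_t.
  by move=> pos; apply: lt_le_trans pos (ler_coef_truncation_exp _ _ (leq_maxr _ _)).
have ge0 m : nonneg_coefs (truncation (maxn M1 M2) ^+ m).
  by apply: nonneg_coefsX; apply: truncation_ge0.
rewrite exprD exprM; split.
  apply: coefM_gt0 => //; first exact: nonneg_coefsX.
    exact: up1.
  by apply: coefX_gt0 => //; apply: up2.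
have -> : (s1 + k * (s2 + e) + d %% e = (s1 + d) + k * s2)%N.
  by rewrite {2}(divn_eq d e) -/k; lia.
apply: coefM_gt0 => //; first exact: nonneg_coefsX.
  exact: up1.
by apply: coefX_gt0 => //; apply: up2.
Qed.

(** The least positive gap h divides every offspring number with positive
    probability.  If s and s + h are both possible values of S_m, then the law
    of S_m dominates b (y^s + y^(s+h)), and squaring this produces a binomial
    component with two trials inside the law of S_(2m). *)
Lemma lattice_block x1 : 0 < p 0%N -> (0 < x1)%N -> 0 < p x1 ->
  exists M m s h (rho : R), [/\ (0 < m)%N, (0 < h)%N, 0 < rho,
    forall x, p x != 0 -> (h %| x)%N &
    forall M', (M <= M')%N -> exists2 G, nonneg_coefs G &
      truncation M' ^+ m = rho *: ('X^s * binker R h 1) + G].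
Proof.
move=> p0_gt0 x1_gt0 px1_gt0.
have reach_supp x : 0 < p x -> reachable_gap x.
  by move=> px; exists x.+1, 1%N, 0%N; rewrite !expr1 !coef_poly /= ltnSn.
pose P := [pred d | `[< (0 < d)%N /\ reachable_gap d >]].
have exP : exists d, P d by exists x1; apply/asboolP; split=> //; apply: reach_supp.
case: (ex_minnP exP) => h /asboolP[h_gt0 reach_h] h_min.
have h_dvd x : p x != 0 -> (h %| x)%N.
  move=> px_neq0; rewrite /dvdn; apply: contraT; rewrite -lt0n => mod_gt0.
  have := h_min (x %% h)%N; rewrite leqNgt ltn_pmod //; apply; apply/asboolP; split=> //.
  by apply: reachable_gap_modn reach_h; apply: reach_supp; rewrite lt_neqAle eq_sym px_neq0 /=.
case: reach_h => M [m [s [lo hi]]].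
have m_gt0 : (0 < m)%N.
  case: m lo hi => // _; rewrite expr0 coef1 addn_eq0 [h == 0%N]eqn0Ngt h_gt0 andbF.
  by rewrite ltxx.
pose b := Num.min (truncation M ^+ m)`_s (truncation M ^+ m)`_(s + h).
have b_gt0 : 0 < b by rewrite lt_min lo.
exists M, (2 * m)%N, (2 * s)%N, h, (4%:R * b ^+ 2); split=> //.
- by rewrite muln_gt0.
- by rewrite mulr_gt0 // exprn_gt0.
move=> M' leMM'; pose B : {poly R} := b *: ('X^s + 'X^(s + h)).
pose G1 := truncation M' ^+ m - B.
have B_ge0 : nonneg_coefs B.
  by move=> i; rewrite coefZ coefD !coefXn mulr_ge0 ?addr_ge0 // ltW.
have G1_ge0 : nonneg_coefs G1.
  move=> i; rewrite coefB coefZ coefD !coefXn subr_ge0.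
  have lift t : b <= (truncation M ^+ m)`_t -> b <= (truncation M' ^+ m)`_t.
    by move=> le; apply: le_trans le (ler_coef_truncation_exp _ _ leMM').
  have [->|ne_s] := eqVneq i s.
    by rewrite -[X in X == _]addn0 eqn_add2l [_ == h]ltn_eqF // addr0 mulr1 lift // ge_min lexx.
  have [->|ne_h] := eqVneq i (s + h)%N.
    by rewrite add0r mulr1 lift // ge_min lexx orbT.
  by rewrite addr0 mulr0; apply: nonneg_coefsX; apply: truncation_ge0.
exists (B * G1 *+ 2 + G1 ^+ 2).
  move=> i; rewrite coefD coefMn addr_ge0 ?mulrn_wge0 //; first exact: nonneg_coefsM.
  exact: nonneg_coefsX.
rewrite mulnC exprM.
have -> : truncation M' ^+ m = B + G1 by rewrite addrC subrK.
rewrite sqrrD -addrA; congr (_ + _).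
rewrite /B /binker expr1 exprZn -[(2 * s)%N]/((s + (s + 0))%N) addn0.
have four : (4%:R * b ^+ 2)%:P * (4%:R^-1)%:P = (b ^+ 2)%:P :> {poly R}.
  by rewrite -polyCM mulrAC divff ?mul1r ?pnatr_eq0.
by rewrite -!mul_polyC -four !exprD; ring.
Qed.

End Truncation.

(** * Comparison of point probabilities *)

Section LocalLimitRatio.
Variables (R : realType) (p : nat -> R) (V : R).
Hypothesis p_ge0 : forall x, 0 <= p x.
Hypothesis mass_le1 : forall M, \sum_(x < M) p x <= 1.
Hypothesis mean_le1 : forall M, \sum_(x < M) p x * x%:R <= 1.
Hypothesis mass_cvg : forall e : R, 0 < e ->
  exists M0, forall M, (M0 <= M)%N -> 1 - e <= \sum_(x < M) p x.
Hypothesis mean_cvg : forall e : R, 0 < e ->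
  exists M0, forall M, (M0 <= M)%N -> 1 - e <= \sum_(x < M) p x * x%:R.
Hypothesis second_le : forall M, \sum_(x < M) p x * (x%:R - 1) ^+ 2 <= V.

Let phi M := truncation p M.

Lemma second_bound_ge0 : 0 <= V.
Proof. by have := second_le 0; rewrite big_ord0. Qed.

Lemma truncation_mass M : (phi M).[1] = \sum_(x < M) p x.
Proof.
by rewrite -expect1 expect_truncation; apply: eq_bigr => i _; rewrite mulr1.
Qed.

Lemma truncation_mass_le1 M : (phi M).[1] <= 1.
Proof. by rewrite truncation_mass. Qed.

Lemma nonneg_factorial_moment M : nonneg_coefs ('X ^+ 2 * (phi M)^`()^`()).
Proof.
apply: nonneg_coefsM; first by move=> i; rewrite coefXn ler0n.
by do 2!apply: nonneg_coefs_deriv; apply: truncation_ge0.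
Qed.

Lemma truncation_factorial_moment M : ('X ^+ 2 * (phi M)^`()^`()).[1] <= V + 1.
Proof.
have -> : ('X ^+ 2 * (phi M)^`()^`()).[1] = \sum_(x < M) p x * (x%:R * (x%:R - 1)).
  rewrite hornerM hornerXn expr1n mul1r /phi /truncation poly_def.
  rewrite (raddf_sum (@deriv R)) /= (raddf_sum (@deriv R)) /= horner_sum.
  apply: eq_bigr => i _.
  rewrite !(derivZ, derivXn, derivMn) hornerZ !hornerMn hornerXn expr1n.
  congr (_ * _); case: (i : nat) => [|k]; first by rewrite mul0r.
  by rewrite -[in RHS]natr1 addrK -mulrnA natr1 -natrM mulnC.
apply: le_trans (lerD (second_le M) (mean_le1 M)); rewrite -big_split /=.
apply: ler_sum => x _; rewrite -mulrDr ler_wpM2l // -subr_ge0.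
by rewrite (_ : _ - _ = 1) //; ring.
Qed.

Section WithBlock.
Variables (M0 m s h : nat) (rho : R).
Hypotheses (m_gt0 : (0 < m)%N) (h_gt0 : (0 < h)%N) (rho_gt0 : 0 < rho).
Hypothesis p_lattice : forall x, p x != 0 -> (h %| x)%N.
Hypothesis block : forall M, (M0 <= M)%N -> exists2 G, nonneg_coefs G &
  phi M ^+ m = rho *: ('X^s * binker R h 1) + G.

Lemma truncation_lattice M : lattice_coefs h (phi M).
Proof.
by move=> i; rewrite coef_poly; case: ifP => [_|]; [exact: p_lattice|rewrite eqxx].
Qed.

Let Cup := (rho^-1 + 1) * Num.sqrt m%:R / 2%:R.

(** The number q of blocks satisfies n <= m (q+1), so 1/sqrt(q+1) is of order
    1/sqrt n. *)
Lemma truncation_upper M n t : (M0 <= M)%N -> (0 < n)%N ->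
  (phi M ^+ n.-1)`_t <= Cup / Num.sqrt n%:R.
Proof.
move=> /block[G G_ge0 blockE] n_gt0.
pose q := (n.-1 %/ m)%N; pose r := (n.-1 %% m)%N.
have nE : n.-1 = (m * q + r)%N by rewrite mulnC -divn_eq.
have lt_rm : (r < m)%N by rewrite ltn_mod.
have sn_gt0 : 0 < Num.sqrt n%:R :> R by rewrite sqrtr_gt0 ltr0n.
have sq_gt0 : 0 < Num.sqrt q.+1%:R :> R by rewrite sqrtr_gt0 ltr0n.
have r_gt0 : 0 < rho^-1 + 1 by rewrite addr_gt0 ?invr_gt0.
rewrite nE; apply: le_trans (coef_upper (truncation_ge0 p_ge0 M) G_ge0 rho_gt0 h_gt0
  (truncation_mass_le1 M) blockE q r t) _.
rewrite ler_pdivrMr ?mulr_gt0 // /Cup.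
have -> : (rho^-1 + 1) * Num.sqrt m%:R / 2%:R / Num.sqrt n%:R * (2%:R * Num.sqrt q.+1%:R) =
  (rho^-1 + 1) * (Num.sqrt m%:R * Num.sqrt q.+1%:R / Num.sqrt n%:R) :> R.
  by field; rewrite gt_eqF //= gt_eqF.
rewrite ler_peMr ?(ltW r_gt0) // ler_pdivlMr // mul1r -sqrtrM ?ler0n //.
rewrite ler_sqrt // -natrM ler_nat -(prednK n_gt0) nE mulnS; lia.
Qed.

Let Clow := lower_constant rho (4%:R * (V + 1)) m / 4%:R.

(** The cut-off M depends on n: the mass and the mean that it loses must be at
    most 1/(4n), so that they stay negligible after n convolutions. *)
Lemma truncation_lower : exists n0, forall n, (n0 <= n)%N -> (0 < n)%N ->
  (h %| n.-1)%N -> exists M1, forall M, (M1 <= M)%N ->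
  Clow / Num.sqrt n%:R <= (phi M ^+ n)`_n.-1.
Proof.
pose b1 : R := 8%:R * m%:R / rho.
pose b2 : R := 2048%:R * (4%:R * (V + 1) + 1) * m%:R ^+ 2 / rho ^+ 2.
exists (maxn (Num.truncn b1).+1 (Num.truncn b2).+1) => n.
rewrite geq_max => /andP[n_b1 n_b2] n_gt0 dvd_n.
have n_ge1 : 1 <= n%:R :> R by rewrite ler1n.
have n_pos : 0 < n%:R :> R by rewrite ltr0n.
have e_gt0 : 0 < (4%:R * n%:R)^-1 :> R by rewrite invr_gt0 mulr_gt0.
have [M1 mass_ge] := mass_cvg e_gt0; have [M2 mean_ge] := mean_cvg e_gt0.
exists (maxn M0 (maxn M1 M2)) => M; rewrite !geq_max => /and3P[le0 le1 le2].
have [G G_ge0 blockE] := block le0.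
have ne : n%:R * (4%:R * n%:R)^-1 = 4%:R^-1 :> R by field; rewrite gt_eqF.
apply: (coef_lower (truncation_ge0 p_ge0 M) G_ge0 rho_gt0 h_gt0
  (truncation_mass_le1 M) blockE (@truncation_lattice M) second_bound_ge0) => //.
- by apply: le_trans (ltW (truncnS_gt _)) _; rewrite ler_nat.
- by apply: le_trans (ltW (truncnS_gt _)) _; rewrite ler_nat.
- have mass_M := mass_ge M le1; rewrite -truncation_mass in mass_M.
  have mass_M1 := truncation_mass_le1 M.
  have bern k : 1 - k%:R * (1 - (phi M).[1]) <= (phi M).[1] ^+ k.
    elim: k => [|k IHk]; first by rewrite mul0r subr0 expr0.
    have M_ge0 : 0 <= (phi M).[1] by apply/horner1_ge0/truncation_ge0.
    have k_ge0 : 0 <= k%:R :> R by [].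
    rewrite exprS; apply: le_trans (ler_wpM2l M_ge0 IHk); rewrite -[k.+1%:R]natr1.
    have := mulr_ge0 k_ge0 (sqr_ge0 (1 - (phi M).[1])).
    by move: (phi M).[1] => x; rewrite -[X in _ -> is_true X]subr_ge0; congr (_ <= _); ring.
  apply: le_trans (bern n); nra.
have mass_M := mass_ge M le1; have mass_M1 := mass_le1 M.
have mean_M := mean_ge M le2; have mean_M1 := mean_le1 M.
have first : `|expect (phi M) (fun i => i%:R - 1)| <= n%:R^-1.
  have -> : expect (phi M) (fun i => i%:R - 1) =
      \sum_(x < M) p x * x%:R - \sum_(x < M) p x.
    rewrite expect_truncation -sumrB; apply: eq_bigr => i _; ring.
  have : (4%:R * n%:R)^-1 <= n%:R^-1 :> R.
    by rewrite lef_pV2 ?posrE ?mulr_gt0 // ler_peMl ?ltW //; lra.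
  rewrite ler_norml; move: mass_M mass_M1 mean_M mean_M1; lra.
have second : expect (phi M) (fun i => (i%:R - 1) ^+ 2) <= V by rewrite expect_truncation.
have [_] := moments_exp (truncation_ge0 p_ge0 M) (truncation_mass_le1 M)
  first second n.
by rewrite divff ?gt_eqF // expr1n.
Qed.

(** For the finitely many small n the constant is read off from the positive
    values of P(S_n = n-1); for large n outside the lattice this probability is
    zero. *)
Lemma ratio_with_block : exists C, forall n, (0 < n)%N ->
  exists M1, forall M, (M1 <= M)%N ->
  (phi M ^+ n)`_n.-1 = 0 \/
  ('X ^+ 2 * (phi M)^`()^`() * phi M ^+ n.-1)`_n.-1 <= C * (phi M ^+ n)`_n.-1.
Proof.
have Cup_gt0 : 0 < Cup.
  by rewrite !mulr_gt0 ?invr_gt0 ?sqrtr_gt0 ?ltr0n // addr_gt0 ?invr_gt0.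
have Clow_gt0 : 0 < Clow by rewrite !divr_gt0 // expR_gt0.
have V1_gt0 : 0 < V + 1 by rewrite ltr_wpDl // second_bound_ge0.
have [n0 lower] := truncation_lower.
pose g n := (phi n ^+ n)`_n.-1.
have g_ge0 n : 0 <= g n by apply: nonneg_coefsX; apply: truncation_ge0.
pose W := \sum_(n < n0) (g n)^-1.
have W_ge0 : 0 <= W by rewrite sumr_ge0 // => n _; rewrite invr_ge0.
have numer_le M n u : 0 <= u -> (forall t, (phi M ^+ n.-1)`_t <= u) ->
    ('X ^+ 2 * (phi M)^`()^`() * phi M ^+ n.-1)`_n.-1 <= (V + 1) * u.
  move=> u_ge0 le_u; apply: le_trans (coefM_le _ (nonneg_factorial_moment M) u_ge0 le_u) _.
  by rewrite ler_wpM2r // truncation_factorial_moment.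
exists ((V + 1) * (W + Cup / Clow)) => n n_gt0.
have [lt_n|le_n] := ltnP n n0.
  exists n => M le_nM.
  have gE : (phi M ^+ n)`_n.-1 = g n.
    by rewrite /g /phi coef_truncation_exp ?prednK // (leq_trans _ le_nM) ?prednK.
  rewrite gE; have [->|g_neq0] := eqVneq (g n) 0; [by left|right].
  have g_gt0 : 0 < g n by rewrite lt_neqAle eq_sym g_neq0 g_ge0.
  apply: le_trans (numer_le M n 1 ler01 _) _.
    move=> t; apply: le_trans (coef_le_horner1 _ (nonneg_coefsX _ (truncation_ge0 p_ge0 M))) _.
    by rewrite horner_exp exprn_ile1 ?truncation_mass_le1 // horner1_ge0 //; apply: truncation_ge0.
  rewrite -mulrA ler_wpM2l ?(ltW V1_gt0) // -ler_pdivrMr // mul1r.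
  rewrite ler_wpDr ?(divr_ge0 (ltW Cup_gt0) (ltW Clow_gt0)) //.
  by rewrite /W (bigD1 (Ordinal lt_n)) //= ler_wpDr // sumr_ge0 // => i _; rewrite invr_ge0.
have [dvd_n|ndvd_n] := boolP (h %| n.-1)%N; last first.
  exists 0%N => M _; left; apply/eqP; apply: contraNT ndvd_n.
  by apply: lattice_coefsX; apply: truncation_lattice.
have [M1 low] := lower n le_n n_gt0 dvd_n.
exists (maxn M0 M1) => M; rewrite geq_max => /andP[le0 le1]; right.
have sn_gt0 : 0 < Num.sqrt n%:R :> R by rewrite sqrtr_gt0 ltr0n.
have u_ge0 : 0 <= Cup / Num.sqrt n%:R by rewrite (divr_ge0 (ltW Cup_gt0) (ltW sn_gt0)).
apply: le_trans (numer_le M n _ u_ge0 (fun t => truncation_upper t le0 n_gt0)) _.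
rewrite -[leRHS]mulrA ler_wpM2l ?(ltW V1_gt0) //.
have c_ge0 : 0 <= W + Cup / Clow by rewrite addr_ge0 // (divr_ge0 (ltW Cup_gt0) (ltW Clow_gt0)).
apply: le_trans (ler_wpM2l c_ge0 (low M le1)).
rewrite mulrA ler_wpM2r ?invr_ge0 ?(ltW sn_gt0) // mulrDl divfK ?gt_eqF //.
by rewrite lerDr mulr_ge0 // ltW.
Qed.

End WithBlock.

Lemma coef_exp_small (A : {poly R}) n t : A`_0 = 0 -> (t < n)%N -> (A ^+ n)`_t = 0.
Proof.
move=> A0; elim: n t => // n IHn t lt_tn; rewrite exprS coefM big1 // => -[[|i] lt_i] _ /=.
  by rewrite A0 mul0r.
by rewrite IHn ?mulr0 //; lia.
Qed.

(** The left side is E[xi_1 (xi_1 - 1) ; S_n = n-1], as soon as M > n. *)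
Lemma local_limit_ratio : exists C, forall n, (0 < n)%N ->
  exists M1, forall M, (M1 <= M)%N ->
  (phi M ^+ n)`_n.-1 = 0 \/
  ('X ^+ 2 * (phi M)^`()^`() * phi M ^+ n.-1)`_n.-1 <= C * (phi M ^+ n)`_n.-1.
Proof.
have [p0|p0_neq0] := eqVneq (p 0%N) 0.
  exists 0 => n n_gt0; exists 1%N => M M_gt0; left; apply: coef_exp_small.
    by rewrite coef_poly M_gt0.
  by rewrite prednK.
have p0_gt0 : 0 < p 0%N by rewrite lt_neqAle eq_sym p0_neq0 p_ge0.
(* otherwise the mean would be 0 *)
have [x1 x1_gt0 px1] : exists2 x, (0 < x)%N & 0 < p x.
  apply: contrapT => no_x; have [M mean_ge] := @mean_cvg 2%:R^-1 ltac:(by rewrite invr_gt0).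
  have := mean_ge M (leqnn _); rewrite big1 => [|i _]; first lra.
  have [->|i_gt0] := posnP i; first by rewrite mulr0.
  have [->|nz] := eqVneq (p i) 0; first by rewrite mul0r.
  by case: no_x; exists (i : nat) => //; rewrite lt_neqAle eq_sym nz p_ge0.
have [M0 [m [s [h [rho [m_gt0 h_gt0 rho_gt0 lat block]]]]]] :=
  lattice_block p_ge0 p0_gt0 x1_gt0 px1.
exact: (ratio_with_block m_gt0 h_gt0 rho_gt0 lat block).
Qed.

End LocalLimitRatio.

(** * Forests as sets of labels *)

Section Labels.

Fixpoint child i a : forest :=
  if a is Graft c b then (if i is i'.+1 then child i' b else c) else Empty.

Fixpoint tree_degree a (v : seq nat) : nat :=
  if v is i :: u then tree_degree (child i a) u else nroots a.

Fixpoint labels j a : seq (seq nat) :=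
  if a is Graft c b then
    [seq j :: u | u <- [::] :: labels 0 c] ++ labels j.+1 b
  else [::].

Definition tree_labels a := [::] :: labels 0 a.

Lemma labels_graft j c b :
  labels j (Graft c b) = [seq j :: u | u <- tree_labels c] ++ labels j.+1 b.
Proof. by []. Qed.

Lemma size_labels j a : size (labels j a) = nverts a.
Proof.
elim: a j => //= c IHc b IHb j.
by rewrite size_cat size_map IHc IHb.
Qed.

(** Recursion on the label rather than on the forest: membership is a descent
    along the label. *)
Fixpoint in_tree a (v : seq nat) : bool :=
  if v is i :: u then (i < nroots a)%N && in_tree (child i a) u else true.

Lemma mem_labels j a v : (v \in labels j a) =
  if v is i :: u then [&& (j <= i)%N, (i < j + nroots a)%N & in_tree (child (i - j) a) u]
  else false.
Proof.
elim: a j v => [|c IHc b IHb] j [|i u] //.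
- by rewrite in_nil addn0; case: leqP.
- rewrite labels_graft mem_cat IHb orbF; apply/mapP => -[] //.
rewrite labels_graft mem_cat IHb /=.
have -> : (i :: u \in [seq j :: u0 | u0 <- tree_labels c]) = (i == j) && in_tree c u.
  have tree_mem w : (w \in tree_labels c) = in_tree c w.
    by rewrite /tree_labels inE IHc; case: w => //= x w; rewrite add0n subn0.
  rewrite -tree_mem; apply/mapP/andP => [[w w_c [-> ->]] //|[/eqP-> u_c]].
  by exists u.
case: (ltngtP j i) => [lt_ji|lt_ij|->] /=.
- by rewrite addSn addnS -(subnSK lt_ji).
- by [].
- by rewrite subnn addnS ltnS leq_addr orbF.
Qed.

Lemma mem_tree_labels a v : (v \in tree_labels a) = in_tree a v.
Proof.
by rewrite /tree_labels inE mem_labels; case: v => //= x w; rewrite add0n subn0.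
Qed.

Lemma tree_labels_uniq a : uniq (tree_labels a).
Proof.
rewrite /tree_labels cons_uniq mem_labels /=.
suff H j : uniq (labels j a) by apply: H.
elim: a j => [|c IHc b IHb] j //; rewrite labels_graft.
rewrite cat_uniq IHb andbT map_inj_uniq; last by move=> u v [].
rewrite /tree_labels cons_uniq mem_labels IHc /=.
apply/hasPn => -[|i u]; rewrite mem_labels // => /and3P[lt_ji _ _].
by apply/negP; rewrite inE => /orP[/eqP[E]|/mapP[w _ [E]]]; rewrite E ltnn in lt_ji.
Qed.

(** The weight of a tree is the product over its vertices of the probabilities
    of their numbers of children, hence the probability that independent
    offspring numbers take these values. *)
Lemma prod_labels_degree (R : comNzRingType) (p : nat -> R) a :
  \prod_(v <- tree_labels a) p (tree_degree a v) = p (nroots a) * weight p a.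
Proof.
rewrite big_cons; congr (_ * _).
suff H j (f : seq nat -> nat) :
    (forall i u, (j <= i)%N -> f (i :: u) = tree_degree (child (i - j) a) u) ->
    \prod_(v <- labels j a) p (f v) = weight p a.
  by apply: H => i u _; rewrite subn0.
elim: a j f => [|c IHc b IHb] j f fE; first by rewrite big_nil.
rewrite labels_graft big_cat big_map big_cons fE // subnn /=; congr (_ * _ * _).
  rewrite -(IHc 0%N (tree_degree c)); last by move=> i u _; rewrite subn0.
  by apply: eq_bigr => u _; rewrite fE // subnn.
by apply: IHb => i u lt_ji; rewrite fE ?(ltnW lt_ji) // -(subnSK lt_ji).
Qed.

(** In a family tree the vertices are the individuals that are ever born. *)
Definition born (c : seq nat -> nat) : set (seq nat) := vertices (family_tree c).

Lemma born_nil c : born c [::].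
Proof. by move=> v i; rewrite prefixs0; case: v. Qed.

Lemma born_rcons c u i : born c (rcons u i) <-> born c u /\ (i < c u)%N.
Proof.
split=> [h|[h lt_i] v k].
  split; last by apply: h; apply: prefix_refl.
  by move=> v k pre; apply: h; apply: prefix_trans pre _; rewrite -cats1 prefix_prefix.
case/prefixP => s; case: (lastP s) => [|{}s x].
  by rewrite cats0 => /esym/rcons_inj[-> ->].
by rewrite -rcons_cat => /rcons_inj[uE _]; apply: h; rewrite uE; apply: prefix_prefix.
Qed.

Lemma born_cons c i u : born c (i :: u) <-> (i < c [::])%N /\ born (fun v => c (i :: v)) u.
Proof.
elim/last_ind: u => [|u k IHu].
  by rewrite -[[:: i]]/(rcons [::] i) born_rcons; split=> -[]; do ?split=> //; apply: born_nil.
by rewrite -rcons_cons !born_rcons IHu; tauto.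
Qed.

(** A family tree determines the number of children of each of its vertices,
    and is determined by these. *)
Lemma eq_born c c' : born c = born c' <-> (forall v, born c' v -> c v = c' v).
Proof.
split=> [E v bv|E].
  have lt_iff i : (i < c v)%N = (i < c' v)%N.
    apply/idP/idP => lt.
      by have : born c (rcons v i) by [apply/born_rcons; rewrite E]; rewrite E => /born_rcons[].
    by have : born c' (rcons v i) by [apply/born_rcons]; rewrite -E => /born_rcons[].
  apply/eqP; rewrite eqn_leq; apply/andP; split.
    by rewrite leqNgt lt_iff ltnn.
  by rewrite leqNgt -lt_iff ltnn.
apply/seteqP; split=> v; elim/last_ind: v => [|v i IHv]; try by move=> _; apply: born_nil.
  by move=> /born_rcons[/IHv bv lt]; apply/born_rcons; rewrite -E.
by move=> /born_rcons[bv lt]; apply/born_rcons; split; [exact: IHv|rewrite E].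
Qed.

Lemma eq_family_tree c c' :
  family_tree c = family_tree c' <-> (forall v, born c' v -> c v = c' v).
Proof.
rewrite -eq_born; split=> [E|E]; first by rewrite /born E.
by rewrite /family_tree; congr RootedTree.
Qed.

Lemma born_tree_degree a v : born (tree_degree a) v <-> v \in tree_labels a.
Proof.
rewrite mem_tree_labels; elim: v a => [|i u IHu] a; first by split=> // _; apply: born_nil.
by rewrite born_cons /= IHu; split=> [[-> ->]|/andP[]].
Qed.

(** The forest of descendants of the ancestor, cut off at generation h. *)
Fixpoint forest_of h (c : seq nat -> nat) : forest :=
  if h is h'.+1 then
    foldr (fun i b => Graft (forest_of h' (fun v => c (i :: v))) b) Empty
      (iota 0 (c [::]))
  else Empty.

Lemma nroots_foldr (F : nat -> forest) r :
  nroots (foldr (fun i b => Graft (F i) b) Empty r) = size r.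
Proof. by elim: r => //= i r ->. Qed.

Lemma child_foldr (F : nat -> forest) r k : (k < size r)%N ->
  child k (foldr (fun i b => Graft (F i) b) Empty r) = F (nth 0%N r k).
Proof. by elim: r k => //= i r IHr [|k] //= /IHr. Qed.

Lemma tree_degree_forest_of h c v : (size v < h)%N -> born c v ->
  tree_degree (forest_of h c) v = c v.
Proof.
elim: v h c => [|i u IHu] [|h] c //= lt_h; first by rewrite nroots_foldr size_iota.
move=> /born_cons[lt_i bu]; rewrite child_foldr ?size_iota // nth_iota // add0n.
exact: IHu.
Qed.

(** A finite family tree is not changed by a cut-off beyond its height. *)
Lemma finite_family_tree c : finite_set (born c) ->
  exists a, family_tree c = family_tree (tree_degree a).
Proof.
case/finite_seqP => s sE; pose h := (\max_(v <- s) size v).+1.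
exists (forest_of h c); apply: esym; apply/eq_family_tree => v bv.
apply: tree_degree_forest_of => //; rewrite ltnS.
by apply: leq_bigmax_seq => //; move: bv; rewrite sE.
Qed.

Lemma has_size_tree a n :
  has_size (family_tree (tree_degree a)) n <-> n = (nverts a).+1.
Proof.
have E : vertices (family_tree (tree_degree a)) = [set` seq_fset tt (tree_labels a)].
  apply/seteqP; split=> v; first by move=> /born_tree_degree; rewrite -(seq_fsetE tt).
  by rewrite /mkset seq_fsetE => /born_tree_degree.
have size_a : #|` seq_fset tt (tree_labels a)| = (nverts a).+1.
  by rewrite size_seq_fset undup_id ?tree_labels_uniq //= size_labels.
rewrite /has_size E -size_a; split=> [/card_eq_fsetP -> //|->].
exact/card_eq_fsetP.
Qed.

End Labels.

(** * Distances in a family tree *)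

Section Distance.

(** The length of the path through the last common ancestor: after the common
    prefix, both labels are walked along to their ends. *)
Fixpoint tree_dist (u v : seq nat) : nat :=
  match u, v with
  | i :: u', j :: v' =>
      if i == j then tree_dist u' v' else (size u + size v)%N
  | _, _ => (size u + size v)%N
  end.

Lemma tree_distC u v : tree_dist u v = tree_dist v u.
Proof.
elim: u v => [|i u IHu] [|j v] //=; rewrite ?addn0 ?add0n //.
by rewrite IHu eq_sym addnC.
Qed.

Lemma tree_dist_rcons u i v :
  (tree_dist (rcons u i) v <= (tree_dist u v).+1)%N /\
  (tree_dist u v <= (tree_dist (rcons u i) v).+1)%N.
Proof.
elim: u v => [|k u IHu] [|j v] /=; rewrite ?size_rcons; try lia.
  by case: (i == j) => /=; lia.
by case: (k == j) => //; lia.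
Qed.

Lemma tree_dist_adjacent t u w v : Defs.adjacent t u w ->
  (tree_dist u v <= (tree_dist w v).+1)%N.
Proof.
case=> _ _ [i [->|->]]; [exact: (tree_dist_rcons u i v).2|exact: (tree_dist_rcons w i v).1].
Qed.

Lemma tree_dist_walk t k u v : walk t k u v -> (tree_dist u v <= k)%N.
Proof.
elim: k u => [|k IHk] u /=.
  by move=> ->; elim: v => //= i v; rewrite eqxx.
by case=> w /tree_dist_adjacent adj /IHk le; apply: leq_trans (adj v) _.
Qed.

Lemma walk_cat t j k u w v : walk t j u w -> walk t k w v -> walk t (j + k) u v.
Proof.
elim: j u => [|j IHj] u /=; first by move=> ->.
by case=> x adj wx wv; exists x => //; apply: IHj.
Qed.

Lemma adjacentC t u v : Defs.adjacent t u v -> Defs.adjacent t v u.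
Proof. by case=> tu tv [i e]; split=> //; exists i; tauto. Qed.

Lemma walkC t k u v : walk t k u v -> walk t k v u.
Proof.
elim: k u => [|k IHk] u /=; first by move=> ->.
case=> w adj /IHk wvw; rewrite -/(walk t k.+1 v u) -addn1.
by apply: walk_cat wvw _; exists u => //; apply: adjacentC.
Qed.

Lemma walk_to_root c u : born c u -> walk (born c) (size u) u [::].
Proof.
elim/last_ind: u => [//|u i IHu] bu; rewrite size_rcons.
have [bu' _] := (born_rcons c u i).1 bu.
by exists u; [split=> //; exists i; right|exact: IHu].
Qed.

Lemma walk_shift c i k u v : (i < c [::])%N ->
  walk (born (fun w => c (i :: w))) k u v -> walk (born c) k (i :: u) (i :: v).
Proof.
move=> lt_i; elim: k u => [|k IHk] u /=; first by move=> ->.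
case=> w [bu bw [x uw]] /IHk ww; exists (i :: w) => //.
split; [exact/born_cons|exact/born_cons|exists x].
by case: uw => ->; [left|right].
Qed.

Lemma walk_tree_dist c u v : born c u -> born c v -> walk (born c) (tree_dist u v) u v.
Proof.
elim: u c v => [|i u IHu] c [|j v] bu bv.
- by [].
- exact/walkC/walk_to_root.
- by rewrite /= addn0; apply: walk_to_root bu.
rewrite /=; case: eqVneq => [E|ne].
  rewrite -E in bv *; apply: walk_shift; first by case/born_cons: bu.
  by apply: IHu; [case/born_cons: bu|case/born_cons: bv].
rewrite -/(size (i :: u)) -/(size (j :: v)).
by apply: walk_cat (walk_to_root bu) _; apply/walkC/walk_to_root.
Qed.

(** The explicit path shows that the distance is at most [tree_dist]; conversely
    [tree_dist] changes by at most 1 along an edge. *)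
Lemma at_distance_tree_dist c k u v : born c u -> born c v ->
  at_distance (born c) k u v -> tree_dist u v = k.
Proof.
move=> bu bv [wk no_shorter]; apply/eqP; rewrite eqn_leq (tree_dist_walk wk) leqNgt.
by apply/negP => /no_shorter; apply; apply: walk_tree_dist.
Qed.

Lemma Z_reroot_le a k v : v \in tree_labels a ->
  (Z k (reroot (family_tree (tree_degree a)) v) <=
   \sum_(u <- tree_labels a) (tree_dist v u == k))%N.
Proof.
move=> v_a; pose s := [seq u <- tree_labels a | tree_dist v u == k].
have <- : size s = (\sum_(u <- tree_labels a) (tree_dist v u == k))%N.
  by rewrite size_filter -sum1_count big_mkcond; apply: eq_bigr => u _; case: eqP.
apply: (@leq_trans #|` seq_fset tt s|); last first.
  by rewrite size_seq_fset size_undup.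
have bE := born_tree_degree a.
have sub u : (vertices (family_tree (tree_degree a)) u /\
    at_distance (vertices (family_tree (tree_degree a))) k v u) -> u \in s.
  move=> [bu dist]; rewrite mem_filter; apply/andP; split; last exact/bE.
  by apply/eqP; apply: at_distance_tree_dist dist => //; apply/bE.
apply: fsubset_leq_card; apply/fsubsetP => u.
rewrite in_fset_set ?inE; first by move/sub; rewrite -(seq_fsetE tt).
apply: sub_finite_set (finite_seq s) => w; exact: sub.
Qed.

(** Needed where the random vertex is not a vertex of the tree, which happens
    with probability zero but is not excluded outright. *)
Lemma Z_reroot_outside c k v : ~ born c v -> (0 < k)%N ->
  Z k (reroot (family_tree c) v) = 0%N.
Proof.
move=> nbv k_gt0; rewrite /Z.
have -> : [set u | vertices (reroot (family_tree c) v) u /\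
   at_distance (vertices (reroot (family_tree c) v)) k
     (Defs.root (reroot (family_tree c) v)) u] = set0.
  apply/seteqP; split=> // u /= [_ [wk _]]; case: k k_gt0 wk => // k _ [w [bv _ _] _].
  by apply: nbv.
by rewrite fset_set0 cardfs0.
Qed.

End Distance.

Section PairCount.

Lemma sum_size_labels k j a :
  (\sum_(u <- labels j a) (size u == k.+1))%N = level k a.
Proof.
elim: a k j => [|c IHc b IHb] k j; first by rewrite big_nil.
rewrite labels_graft big_cat big_map big_cons IHb /=; congr (_ + _)%N.
case: k => [|k].
  rewrite eqxx big1_seq ?addn0 // => u /andP[_]; rewrite mem_labels.
  by case: u => // x u _.
rewrite add0n -(IHc k 0%N); apply: eq_bigr => u _; by rewrite eqSS.
Qed.

Lemma sum_size_tree_labels k a :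
  (\sum_(u <- tree_labels a) (size u == k))%N = tree_level k a.
Proof.
rewrite big_cons; case: k => [|k]; last by rewrite add0n sum_size_labels.
rewrite big1_seq ?addn0 // => u /andP[_]; rewrite mem_labels.
by case: u => // x u _.
Qed.

Lemma sum_dist_across d j c b :
  (\sum_(u <- tree_labels c) \sum_(v <- labels j.+1 b) (tree_dist (j :: u) v == d.+2))%N =
  (\sum_(i < d.+1) tree_level i c * level (d - i) b)%N.
Proof.
transitivity (\sum_(u <- tree_labels c) \sum_(i < d.+1) (size u == i) * level (d - i) b)%N.
  apply: eq_bigr => u _.
  transitivity (\sum_(v <- labels j.+1 b) (size u + size v == d.+1))%N.
    apply: eq_big_seq => -[|i v]; rewrite mem_labels // => /and3P[lt_ji _ _] /=.
    by rewrite (ltn_eqF lt_ji); congr (nat_of_bool _); apply/eqP/eqP; lia.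
  have [le_ud|lt_du] := leqP (size u) d.
    rewrite [RHS](bigD1 (Ordinal (le_ud : size u < d.+1)%N)) //= eqxx mul1n.
    rewrite [X in (_ + X)%N]big1 ?addn0.
      rewrite -(sum_size_labels (d - size u) j.+1); apply: eq_bigr => v _.
      by congr (nat_of_bool _); apply/eqP/eqP; lia.
    move=> i ne; rewrite (_ : (size u == i) = false) //.
    by apply: contraNF ne => /eqP E; apply/eqP/val_inj; rewrite /= E.
  rewrite [RHS]big1 => [|i _]; last first.
    by rewrite (_ : (size u == i) = false) //; apply/eqP; have := ltn_ord i; lia.
  rewrite big1_seq // => -[|i v] /andP[_]; rewrite mem_labels // => _ /=.
  by apply/eqP; rewrite eqb0; apply/eqP; lia.
rewrite exchange_big; apply: eq_bigr => i _.
by rewrite -sum_size_tree_labels big_distrl.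
Qed.

(** Pairs within a tree of the forest are counted by [pairs], and pairs across
    two trees by [cross]; for k = 1 there are none of the latter. *)
Lemma sum_dist_labels k j a : (0 < k)%N ->
  (\sum_(u <- labels j a) \sum_(v <- labels j a) (tree_dist u v == k))%N =
  ((if k is d.+2 then cross d a else 0) + pairs k a)%N.
Proof.
move=> k_gt0; elim: a j => [|c IHc b IHb] j; first by rewrite big_nil; case: k k_gt0 => [|[]].
pose X := (if k is d.+2 then \sum_(i < d.+1) tree_level i c * level (d - i) b else 0)%N.
have across : (\sum_(u <- tree_labels c) \sum_(v <- labels j.+1 b)
    (tree_dist (j :: u) v == k))%N = X.
  rewrite /X; case: k k_gt0 {IHc IHb X} => [|[|d]] // _; last exact: sum_dist_across.
  rewrite big1_seq // => u _; rewrite big1_seq // => -[|i v] /andP[_]; rewrite mem_labels //.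
  case/and3P => lt_ji _ _ /=; rewrite (ltn_eqF lt_ji).
  by apply/eqP; rewrite eqb0; apply/eqP; lia.
have across' : (\sum_(u <- labels j.+1 b) \sum_(v <- tree_labels c)
    (tree_dist u (j :: v) == k))%N = X.
  rewrite -across exchange_big; apply: eq_bigr => u _; apply: eq_bigr => v _.
  by rewrite tree_distC.
have diag : (\sum_(u <- tree_labels c) \sum_(v <- tree_labels c)
    (tree_dist (j :: u) (j :: v) == k))%N =
    (apex_pairs k c + pairs k c)%N.
  transitivity (\sum_(u <- tree_labels c) \sum_(v <- tree_labels c)
      (tree_dist u v == k))%N.
    by apply: eq_bigr => u _; apply: eq_bigr => v _; rewrite /= eqxx.
  have T := sum_size_tree_labels k c; rewrite big_cons /= eq_sym eqn0Ngt k_gt0 add0n in T.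
  rewrite [LHS]big_cons [X in (X + _)%N]big_cons /= eq_sym eqn0Ngt k_gt0 add0n T.
  under eq_bigr do rewrite big_cons.
  rewrite big_split /= IHc.
  have -> : (\sum_(u <- labels 0 c) (tree_dist u [::] == k) = tree_level k c)%N.
    by rewrite -T; apply: eq_bigr => u _; rewrite tree_distC.
  by rewrite /apex_pairs; lia.
have split_labels F : (\sum_(u <- labels j (Graft c b)) F u =
    \sum_(u <- tree_labels c) F (j :: u) + \sum_(u <- labels j.+1 b) F u)%N.
  by rewrite labels_graft big_cat big_map.
rewrite split_labels; under eq_bigr do rewrite split_labels.
under [X in (_ + X)%N]eq_bigr do rewrite split_labels.
rewrite !big_split /= diag across across' IHb /X.
by case: k {X k_gt0 IHc IHb across across' diag} => [|[|d]] /=; lia.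
Qed.

Lemma sum_dist_tree_labels k a : (0 < k)%N ->
  (\sum_(u <- tree_labels a) \sum_(v <- tree_labels a) (tree_dist u v == k))%N =
  tree_pairs k a.
Proof.
move=> k_gt0; have := sum_dist_labels 0 (Graft a Empty) k_gt0.
rewrite labels_graft cats0 big_map; under eq_bigr do rewrite big_map.
have -> : (if k is d.+2 then cross d (Graft a Empty) else 0)%N = 0%N.
  case: k k_gt0 => [|[|d]] //= _; rewrite addn0 big1 // => i _; exact: muln0.
by rewrite add0n /tree_pairs => <-; apply: eq_bigr => u _; apply: eq_bigr => v _.
Qed.

End PairCount.

(** * Passage to the random tree *)

(** Hence distinct forests give disjoint events for the random tree. *)
Lemma in_tree_inj a a' : in_tree a =1 in_tree a' -> a = a'.
Proof.
elim: a a' => [|c IHc b IHb] [|c' b'] E //; try by have := E [:: 0%N].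
congr Graft.
  by apply: IHc => v; have := E (0%N :: v).
by apply: IHb => -[|i u] //; have := E (i.+1 :: u).
Qed.

Lemma nroots_le_nverts a : (nroots a <= nverts a)%N.
Proof. by elim: a => //= c _ b IHb; rewrite ltnS (leq_trans IHb) // leq_addl. Qed.

Lemma eq_weight (R : comNzRingType) (p q : nat -> R) M a :
  (forall x, (x < M)%N -> p x = q x) -> (nverts a < M)%N -> weight p a = weight q a.
Proof.
move=> eq_pq; elim: a => //= c IHc b IHb lt_M.
by rewrite IHc ?IHb ?eq_pq //; have := nroots_le_nverts c; lia.
Qed.

Section DiscreteLaw.
Context d (T : measurableType d) (R : realType) (P : probability T R).
Variable X : {RV P >-> nat}.

Definition point_mass x : R := fine (P (X @^-1` [set x])).

Lemma measurable_fiber x : measurable (X @^-1` [set x]).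
Proof. exact: measurable_funPTI. Qed.

Lemma point_massE x : P (X @^-1` [set x]) = (point_mass x)%:E.
Proof. by rewrite fineK // fin_num_measure //; apply: measurable_fiber. Qed.

Lemma point_mass_ge0 x : 0 <= point_mass x.
Proof. by rewrite fine_ge0. Qed.

Lemma integral_discrete (F : nat -> R) : (forall x, 0 <= F x) ->
  (\int[P]_w (F (X w))%:E = \sum_(x <oo) (point_mass x * F x)%:E)%E.
Proof.
move=> F_ge0.
have cover : \bigcup_x (X @^-1` [set x]) = setT.
  by apply/seteqP; split=> // w _; exists (X w).
rewrite -cover ge0_integral_bigcup //=.
- apply: eq_eseriesr => x _.
  rewrite (eq_integral (fun=> (F x)%:E)); last by move=> w /[!inE] /= ->.
  rewrite integral_cst; last exact: measurable_fiber.
  by transitivity ((F x)%:E * (point_mass x)%:E)%E; [rewrite -point_massE|rewrite -EFinM mulrC].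
- by move=> x; apply: measurable_fiber.
- rewrite cover; apply/measurable_EFinP.
  exact: (measurableT_comp (f := F)).
- by move=> w _; rewrite lee_fin.
- by apply/trivIsetP => i j _ _ /eqP ne; apply/seteqP; split=> // w /= [-> /ne].
Qed.

Lemma partial_sum_le (u : nat -> R) (l : R) : (forall x, 0 <= u x) ->
  (\sum_(x <oo) (u x)%:E = l%:E)%E -> forall M, \sum_(x < M) u x <= l.
Proof.
move=> u_ge0 uE M; rewrite -lee_fin -uE -sumEFin -(big_mkord xpredT (fun x => (u x)%:E)).
by apply: nneseries_lim_ge => x _ _; rewrite lee_fin.
Qed.

Lemma partial_sum_cvg (u : nat -> R) (l : R) : (forall x, 0 <= u x) ->
  (\sum_(x <oo) (u x)%:E = l%:E)%E -> forall e : R, 0 < e ->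
  exists M0, forall M, (M0 <= M)%N -> l - e <= \sum_(x < M) u x.
Proof.
move=> u_ge0 uE e e_gt0.
have cv : ((fun n => \sum_(0 <= x < n) (u x)%:E) @ \oo --> l%:E)%E.
  rewrite -uE; apply: is_cvg_nneseries => x _ _; by rewrite lee_fin.
have {}cv : (fun n => \sum_(0 <= x < n) u x) @ \oo --> l.
  rewrite (_ : (fun n => _) = fine \o (fun n => \sum_(0 <= x < n) (u x)%:E)%E).
    exact: fine_cvg cv.
  by apply/funext => n; rewrite /= sumEFin.
move/cvgrPdist_le: cv => /(_ e e_gt0)[M0 _ M0P].
exists M0 => M /M0P; rewrite /= big_mkord ler_norml => /andP[_]; lra.
Qed.

End DiscreteLaw.

Section CriticalLaw.
Context d (T : measurableType d) (R : realType) (P : probability T R).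
Variable X : {RV P >-> nat}.
Hypothesis X_mean : ('E_P[fun w => (X w)%:R] = 1)%E.
Hypothesis X_var : ('V_P[fun w => (X w)%:R] < +oo)%E.
Let p := point_mass X.

Lemma mass_series : (\sum_(x <oo) (p x)%:E = 1%:E)%E.
Proof.
have := @integral_discrete _ _ _ P X (fun=> 1) (fun=> ler01).
rewrite integral_cst // mul1e => uE.
transitivity (P setT); last exact: probability_setT.
by apply: etrans (esym uE); apply: eq_eseriesr => x _; rewrite mulr1.
Qed.

Lemma mean_series : (\sum_(x <oo) (p x * x%:R)%:E = 1%:E)%E.
Proof.
rewrite -(@integral_discrete _ _ _ P X (fun x => x%:R)); last by move=> x; rewrite ler0n.
by move: X_mean; rewrite unlock.
Qed.

Lemma variance_series : exists V,
  (\sum_(x <oo) (p x * (x%:R - 1) ^+ 2)%:E = V%:E)%E.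
Proof.
exists (fine 'V_P[fun w => (X w)%:R]).
rewrite -(@integral_discrete _ _ _ P X (fun x => (x%:R - 1) ^+ 2)); last by move=> x; rewrite sqr_ge0.
have VE : ('V_P[fun w => (X w)%:R] = \int[P]_w (((X w)%:R - 1) ^+ 2)%:E)%E.
  rewrite /variance unlock X_mean /= unlock; apply: eq_integral => w _.
  by rewrite expr2.
rewrite fineK // ?VE // ge0_fin_numE -?VE //.
by rewrite VE; apply: integral_ge0 => w _; rewrite lee_fin sqr_ge0.
Qed.

End CriticalLaw.

Section ConditionedTree.
Context {R : realType} {d0 : measure_display} {T0 : measurableType d0}.
Context {P0 : probability T0 R} (xi : {RV P0 >-> nat}).
Context {d : measure_display} {T : measurableType d} (P : probability T R).
Variables (c : seq nat -> {RV P >-> nat}) (V : T -> seq nat).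
Hypotheses (c_iid : offspring_family xi c) (V_unif : uniform_vertex c V).
Let p := point_mass xi.

Definition tree_event a : set T :=
  [set w | GW_tree c w = family_tree (tree_degree a)].

(** The event is a constraint on finitely many offspring numbers. *)
Lemma tree_eventE a : tree_event a =
  \bigcap_(v in [set` tree_labels a]) (c v @^-1` [set tree_degree a v]).
Proof.
apply/seteqP; split=> w /=; first by move=> /eq_family_tree E v /= /born_tree_degree /E.
by move=> E; apply/eq_family_tree => v /born_tree_degree /E.
Qed.

Lemma measurable_tree_event a : measurable (tree_event a).
Proof.
rewrite tree_eventE; apply: fin_bigcap_measurable; first exact: finite_seq.
by move=> v _; apply: measurable_fiber.
Qed.

Definition tree_weight a := p (nroots a) * weight p a.

Lemma probability_tree_event a : P (tree_event a) = (tree_weight a)%:E.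
Proof.
rewrite tree_eventE (c_iid.1 (tree_labels a) (fun v => [set tree_degree a v]));
  [|exact: tree_labels_uniq|by []].
rewrite /tree_weight -prod_labels_degree -prodEFin; apply: eq_bigr => v _.
rewrite -point_massE; exact: c_iid.2.
Qed.

Lemma tree_event_inj a a' w : tree_event a w -> tree_event a' w -> a = a'.
Proof.
rewrite /tree_event /= => -> E; apply: in_tree_inj => v.
rewrite -!mem_tree_labels; apply/idP/idP => /born_tree_degree; rewrite /born.
  by rewrite E => /born_tree_degree.
by rewrite -E => /born_tree_degree.
Qed.

Lemma GW_has_size_event n w : GW_has_size c n.+1 w ->
  exists2 a, nverts a = n & tree_event a w.
Proof.
rewrite /GW_has_size /= => sz.
have [a E] : exists a, GW_tree c w = family_tree (tree_degree a).
  by apply: finite_family_tree; apply/finite_setP; exists n.+1.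
exists a => //; have := sz; rewrite E => /has_size_tree; lia.
Qed.

Lemma tree_event_GW_has_size a w : tree_event a w -> GW_has_size c (nverts a).+1 w.
Proof. by rewrite /GW_has_size /= => ->; apply/has_size_tree. Qed.

Lemma sum_tree_events (F : forest -> R) a w : tree_event a w ->
  \sum_(b <- forests (nverts a)) \1_(tree_event b) w * F b = F a.
Proof.
move=> aw; transitivity (\sum_(b <- forests (nverts a)) if b == a then F a else 0).
  apply: eq_bigr => b _; rewrite indicE; case: eqP => [->|ne].
    by rewrite mem_set // mul1r.
  by rewrite memNset ?mul0r // => bw; apply: ne; apply: tree_event_inj bw aw.
by rewrite sum_forests_pick eqxx.
Qed.

Lemma sum_tree_events_outside (F : forest -> R) n w : ~ GW_has_size c n.+1 w ->
  \sum_(b <- forests n) \1_(tree_event b) w * F b = 0.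
Proof.
move=> nsz; rewrite big_seq big1 // => b; rewrite mem_forests => /eqP bn.
by rewrite indicE memNset ?mul0r // => /tree_event_GW_has_size; rewrite bn.
Qed.

Lemma measurable_GW_has_size n : measurable (GW_has_size c n.+1).
Proof.
have -> : GW_has_size c n.+1 = \bigcup_(a in [set` forests n]) tree_event a.
  apply/seteqP; split=> w.
    by case/GW_has_size_event => a an aw; exists a; rewrite //= mem_forests an.
  by case=> a /=; rewrite mem_forests => /eqP <- /tree_event_GW_has_size.
apply: fin_bigcup_measurable; first exact: finite_seq.
by move=> a _; apply: measurable_tree_event.
Qed.

Lemma integral_sum_indic (I : Type) (r : seq I) (E : I -> set T) (u : I -> R) :
  (forall i, measurable (E i)) -> (forall i, 0 <= u i) ->
  (\int[P]_w (\sum_(i <- r) \1_(E i) w * u i)%:E = \sum_(i <- r) P (E i) * (u i)%:E)%E.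
Proof.
move=> mE u_ge0; under eq_integral do rewrite -sumEFin.
rewrite ge0_integral_sum //.
- apply: eq_bigr => i _; under eq_integral do rewrite EFinM muleC.
  rewrite (@ge0_integralZl_EFin _ _ _ P setT measurableT (fun w => (\1_(E i) w)%:E)) //.
    by rewrite integral_indic // setIT muleC.
  by apply/measurable_EFinP.
- by move=> i; apply/measurable_EFinP; apply: measurable_funM.
- by move=> i w _; rewrite lee_fin mulr_ge0.
Qed.

Lemma probability_GW_has_size n :
  P (GW_has_size c n.+1) = (\sum_(a <- forests n) tree_weight a)%:E.
Proof.
have mA := measurable_GW_has_size n.
have := integral_indic P measurableT mA; rewrite setIT => <-.
rewrite (eq_integral (fun w => (\sum_(a <- forests n) \1_(tree_event a) w * 1)%:E)).
  rewrite integral_sum_indic //; last exact: measurable_tree_event.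
  by rewrite -sumEFin; apply: eq_bigr => a _; rewrite mule1 probability_tree_event.
move=> w _; congr (_%:E); rewrite indicE.
have [/GW_has_size_event[a <- aw]|nsz] := pselect (GW_has_size c n.+1 w).
  by rewrite (sum_tree_events (fun=> 1) aw) mem_set //; apply: tree_event_GW_has_size.
by rewrite (sum_tree_events_outside (fun=> 1) nsz) memNset.
Qed.

Definition vertex_event a v : set T :=
  [set w | GW_tree c w = family_tree (tree_degree a) /\ V w = v].

Lemma probability_vertex_event a v : v \in tree_labels a ->
  P (vertex_event a v) = ((nverts a).+1%:R^-1 * tree_weight a)%:E.
Proof.
move=> v_a; rewrite EFinM -probability_tree_event; apply: V_unif.2.
  exact/has_size_tree.
exact/born_tree_degree.
Qed.

Lemma measurable_vertex_event a v : measurable (vertex_event a v).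
Proof. exact: measurableI (measurable_tree_event a) (V_unif.1 v). Qed.

Lemma tree_weight_ge0 a : 0 <= tree_weight a.
Proof. by rewrite -lee_fin -probability_tree_event. Qed.

(** On the event that the tree has n+1 vertices the integrand takes finitely
    many values, one for each tree and each of its vertices; summing over the
    vertices, each with conditional probability 1/(n+1), counts pairs. *)
Lemma integral_level n k : (0 < k)%N ->
  (\int[P]_(w in GW_has_size c n.+1) (Z k (reroot (GW_tree c w) (V w)))%:R%:E <=
   (n.+1%:R^-1 * \sum_(a <- forests n) tree_weight a * (tree_pairs k a)%:R)%:E)%E.
Proof.
move=> k_gt0; pose z a v : R := (Z k (reroot (family_tree (tree_degree a)) v))%:R.
pose vertices_of n := [seq (a, v) | a <- forests n, v <- tree_labels a].
rewrite integral_mkcond.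
rewrite (eq_integral (fun w => (\sum_(av <- vertices_of n)
    \1_(vertex_event av.1 av.2) w * z av.1 av.2)%:E)); last first.
  move=> w _; rewrite /patch big_allpairs_dep /=.
  have inner a : \sum_(v <- tree_labels a) \1_(vertex_event a v) w * z a v =
      \1_(tree_event a) w * (if V w \in tree_labels a then z a (V w) else 0).
    rewrite indicE; case: (boolP (w \in tree_event a)) => [/set_mem aw|]; last first.
      move=> /negP naw; rewrite mul0r big1 // => v _; rewrite indicE memNset ?mul0r //.
      by move=> -[aw _]; apply: naw; apply/mem_set.
    rewrite mul1r; case: ifPn => [Vw|nVw].
      rewrite (bigD1_seq (V w)) ?tree_labels_uniq //= indicE mem_set // mul1r.
      rewrite big1 ?addr0 // => v /eqP ne; rewrite indicE memNset ?mul0r //.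
      by move=> -[_ E]; apply: ne.
    rewrite big1_seq // => v /andP[_ v_a]; rewrite indicE memNset ?mul0r //.
    by move=> -[_ E]; rewrite E v_a in nVw.
  under eq_bigr do rewrite inner.
  case: ifPn => [/set_mem /GW_has_size_event[a <- aw]|/negP nsz].
    rewrite (sum_tree_events _ aw) /z; move: aw; rewrite /tree_event /= => ->.
    case: ifPn => // /negP nVw; rewrite Z_reroot_outside // => /born_tree_degree //.
  rewrite sum_tree_events_outside //; move=> sz; apply: nsz; exact/mem_set.
rewrite integral_sum_indic; first last.
- by move=> av; rewrite ler0n.
- by move=> av; apply: measurable_vertex_event.
rewrite big_allpairs_dep /= mulr_sumr -sumEFin big_seq [leRHS]big_seq.
apply: lee_sum => a; rewrite mem_forests => /eqP an.
rewrite (eq_big_seq (fun v => ((n.+1%:R^-1 * tree_weight a) * z a v)%:E)); last first.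
  by move=> v v_a; rewrite probability_vertex_event // an EFinM.
rewrite sumEFin lee_fin -mulr_sumr [leRHS]mulrA ler_wpM2l //.
  by rewrite mulr_ge0 ?invr_ge0 // tree_weight_ge0.
rewrite -sum_dist_tree_labels // natr_sum big_seq [leRHS]big_seq.
apply: ler_sum => v v_a; rewrite /z ler_nat; apply: leq_trans (Z_reroot_le k v_a) _.
by apply: leq_sum => u _; rewrite tree_distC.
Qed.

End ConditionedTree.

(** * The rerooted conditioned tree *)

Theorem corollary1p2 (R : realType)
    (d0 : measure_display) (T0 : measurableType d0) (P0 : probability T0 R)
    (xi : {RV P0 >-> nat})
    (xi_mean : ('E_P0[fun w => (xi w)%:R] = 1)%E)
    (xi_var : (0 < 'V_P0[fun w => (xi w)%:R] < +oo)%E) :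
  exists C : R,
    forall (d : measure_display) (T : measurableType d) (P : probability T R)
      (c : seq nat -> {RV P >-> nat}) (V : T -> seq nat),
      offspring_family xi c -> uniform_vertex c V ->
      forall n k : nat, (1 <= n)%N -> (1 <= k)%N ->
        (0 < P (GW_has_size c n))%E ->
        (expected_level c V n k <= (C * k%:R)%:E)%E.
Proof.
pose p := point_mass xi; have p_ge0 x : 0 <= p x by apply: point_mass_ge0.
have pm_ge0 x : 0 <= p x * x%:R by rewrite mulr_ge0.
have pv_ge0 x : 0 <= p x * (x%:R - 1) ^+ 2 by rewrite mulr_ge0 ?sqr_ge0.
have [V0 var_eq] := variance_series xi_mean (andP xi_var).2.
have mass_eq := mass_series xi; have mean_eq := mean_series xi_mean.
have [C ratio] := local_limit_ratio p_ge0
  (partial_sum_le p_ge0 mass_eq) (partial_sum_le pm_ge0 mean_eq)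
  (partial_sum_cvg p_ge0 mass_eq) (partial_sum_cvg pm_ge0 mean_eq)
  (partial_sum_le pv_ge0 var_eq).
exists (2%:R + `|C|) => d T P c V c_iid V_unif [//|n] k _ k_gt0 PA_gt0.
have [M1 ratio_M] := ratio n.+1 isT; pose M := maxn M1 n.+2.
set phi := truncation p M; have phi_ge0 : nonneg_coefs phi by apply: truncation_ge0.
have p_phi x : (x < n.+2)%N -> p x = phi`_x.
  by move=> lt; rewrite coef_poly (leq_trans lt) // leq_maxr.
(* a tree with n.+1 vertices has no vertex with more than n children *)
have tree_weightE a : a \in forests n ->
    tree_weight xi a = phi`_(nroots a) * weight (nth 0 phi) a.
  rewrite mem_forests => /eqP an; rewrite /tree_weight (@eq_weight _ _ (nth 0 phi) n.+2).
  - by rewrite -p_phi // (leq_ltn_trans (nroots_le_nverts a)) // an.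
  - exact: p_phi.
  - by rewrite an.
have sumE g : \sum_(a <- forests n) tree_weight xi a * g a = tree_sum (nth 0 phi) g n.+1.
  rewrite /tree_sum coef_zvarM /forest_sum; apply: eq_big_seq => a a_n.
  by rewrite tree_weightE // -mulrA mulrCA.
pose W := \sum_(a <- forests n) tree_weight xi a.
have cycle : n.+1%:R * W = (phi ^+ n.+1)`_n.
  have -> : W = tree_sum (nth 0 phi) (fun=> 1) n.+1.
    by rewrite -sumE; apply: eq_bigr => a _; rewrite mulr1.
  by rewrite (cycle_lemma (tree_series_eq phi)) coefXM.
have W_gt0 : 0 < W by rewrite -lte_fin -(probability_GW_has_size c_iid).
have f_gt0 : 0 < (phi ^+ n.+1)`_n by rewrite -cycle mulr_gt0.
rewrite /expected_level /conditional_expectation (probability_GW_has_size c_iid) /=.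
apply: le_trans (lee_wpmul2l _ (integral_level c_iid V_unif n k_gt0)) _.
  by rewrite lee_fin invr_ge0 ltW.
rewrite -EFinM lee_fin sumE mulrA -invfM [W * _]mulrC cycle mulrC ler_pdivrMr //.
apply: le_trans (pairs_bound phi_ge0 (ltn0Sn n) k_gt0) _.
have ratio_f : ('X ^+ 2 * phi^`()^`() * phi ^+ n)`_n <= `|C| * (phi ^+ n.+1)`_n.
  case: (ratio_M M (leq_maxl _ _)) => [f0|le]; first by rewrite f0 ltxx in f_gt0.
  by apply: le_trans le _; rewrite ler_wpM2r ?ler_norm // ltW.
move: f_gt0 ratio_f; rewrite /=.
move: (phi ^+ n.+1)`_n ('X ^+ 2 * phi^`()^`() * phi ^+ n)`_n.
move=> f g f_gt0 ratio_f.
rewrite -(mulr_natr f) -(mulr_natr g); case: k k_gt0 => // k _ /=.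
have k_ge0 : 0 <= k%:R :> R by [].
have := ler_wpM2r k_ge0 ratio_f; have := mulr_ge0 (ltW f_gt0) k_ge0.
have := mulr_ge0 (normr_ge0 C) (ltW f_gt0); rewrite -[k.+1%:R]natr1; lra.
Qed.
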